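(* Let $n\ge3$, $\alpha\in(0,n)$, $p,q>0$ with $pq>1$, and assume $\frac{1}{p+1}+\frac{1}{q+1}\le\frac{n-\alpha}{n}$. If $(u,v)\in L^{r_0}(\mathbb{R}^n)\times L^{s_0}(\mathbb{R}^n)$, where $r_0=\frac{n(pq-1)}{\alpha(q+1)}$, $s_0=\frac{n(pq-1)}{\alpha(p+1)}$, is a pair of positive solutions of $$u(x)=\int_{\mathbb{R}^n}\frac{v^q(y)\,dy}{|x-y|^{n-\alpha}},\qquad v(x)=\int_{\mathbb{R}^n}\frac{u^p(y)\,dy}{|x-y|^{n-\alpha}},$$ then $u,v$ are bounded on $\mathbb{R}^n$ and $\lim_{|x|\to\infty}u(x)=\lim_{|x|\to\infty}v(x)=0$.
   Context: Positive solutions are positive measurable functions satisfying both integral identities (finite) at every point. *)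

(* Defs.v *)
(* R^n is modelled as [n.-tuple R] equipped with
   the library's product (tuple) sigma-algebra of Borel sets of R. *)
From HB Require Import structures.
From mathcomp Require Import all_boot all_order all_algebra.
From mathcomp Require Import all_classical all_reals all_analysis.
Set Implicit Arguments. Unset Strict Implicit. Unset Printing Implicit Defensive.
Import Order.TTheory GRing.Theory Num.Theory.
Local Open Scope ring_scope.
Local Open Scope classical_set_scope.

Definition enorm (R : realType) (n : nat) (x : n.-tuple R) : R :=
  Num.sqrt (\sum_(i < n) (tnth x i) ^+ 2).

Definition edist (R : realType) (n : nat) (x y : n.-tuple R) : R :=
  Num.sqrt (\sum_(i < n) (tnth x i - tnth y i) ^+ 2).

Definition box (R : realType) (n : nat) (a b : n.-tuple R) : set (n.-tuple R) :=
  [set x | forall i : 'I_n, tnth a i <= tnth x i <= tnth b i].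

(* mu is the (Borel) Lebesgue measure on R^n: the measure on the Borel sets of
   R^n giving every box the product of its side lengths (unique such measure). *)
Definition is_lebesgue_measure_n (R : realType) (n : nat)
  (mu : {measure set (n.-tuple R) -> \bar R}) : Prop :=
  forall a b : n.-tuple R, (forall i : 'I_n, tnth a i <= tnth b i) ->
    mu (box a b) = (\prod_(i < n) (tnth b i - tnth a i))%:E.

Definition in_Lp (R : realType) (n : nat)
  (mu : {measure set (n.-tuple R) -> \bar R}) (r : R) (f : n.-tuple R -> R) : Prop :=
  measurable_fun [set: n.-tuple R] f /\
  (\int[mu]_x ((`| f x | `^ r)%:E) < +oo)%E.

Definition riesz_pot (R : realType) (n : nat)
  (mu : {measure set (n.-tuple R) -> \bar R}) (alpha : R)
  (g : n.-tuple R -> R) (x : n.-tuple R) : \bar R :=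
  (\int[mu]_y ((g y / (edist x y) `^ (n%:R - alpha))%:E))%E.

Definition bounded_fun_Rn (R : realType) (n : nat) (f : n.-tuple R -> R) : Prop :=
  exists M : R, forall x, `| f x | <= M.

Definition vanish_at_infinity (R : realType) (n : nat) (f : n.-tuple R -> R) : Prop :=
  forall eps : R, 0 < eps -> exists M : R, forall x, M < enorm x -> `| f x | < eps.

(* Main.v *)
(* No Hardy-Littlewood-Sobolev inequality is needed. Put
   a = alpha (q + 1) / (p q - 1) and b = alpha (p + 1) / (p q - 1), so that
   r_0 = n / a, s_0 = n / b, b q = a + alpha and a p = b + alpha, and measure the
   level sets scale by scale, with radius r corresponding to the levels u > r^-a
   and v > r^-b and to the volume r^n. By scaling, the part of v^q where
   v <= r^-b has potential at most C r^-a (near part: sup bound; far part: the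
   L^(s_0) bound through Young's inequality). Hence on E = {u > (rho r)^-a},
   with rho small, the potential of v^q 1_{v > r^-b} is at least (rho r)^-a / 2.
   Integrating over E by Tonelli and using I(1_E) <= C |E|^(alpha/n), one gets
   that if the normalized measures of the level sets of v below scale r are at most
   beta, that of u at scale rho r is at most C beta^(n/(n - alpha)), which is
   superlinear in beta. As these measures tend to 0 (Chebyshev), they decay
   faster than any power of the level, for u and v simultaneously; so the
   potentials are bounded, and they vanish at infinity because the tails of the
   L^p norms do. *)
Require Import Defs.
From HB Require Import structures.
From mathcomp Require Import all_boot all_order all_algebra.
From mathcomp Require Import all_classical all_reals all_analysis.
From mathcomp Require Import measurable_realfun.
From mathcomp Require Import ring lra.
Set Implicit Arguments. Unset Strict Implicit. Unset Printing Implicit Defensive.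
Import Order.TTheory GRing.Theory Num.Theory.
Import numFieldNormedType.Exports.
Local Open Scope ring_scope.
Local Open Scope classical_set_scope.

Local Notation edist := Defs.edist.

(** * Integral estimates *)

Section integral_estimates.
Context d (T : measurableType d) (R : realType).
Variable mu : {measure set T -> \bar R}.
Local Open Scope ereal_scope.

(** Comparison with a geometric series: every partial sum is at most [c / (1 - z)], and the bound
    passes to the limit. *)
Lemma nneseries_le_geometric (t : nat -> \bar R) (c z : R) :
  (0 <= c)%R -> (0 < z < 1)%R -> (forall j, 0 <= t j) ->
  (forall j, t j <= (c * z ^+ j)%:E) ->
  \sum_(0 <= j <oo) t j <= (c / (1 - z))%:E.
Proof.
move=> c0 /andP[z0 z1] t0 tle.
apply: lime_le; first by apply: is_cvg_nneseries => j _ _; exact: t0.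
apply: nearW => k.
apply: (@le_trans _ _ (\sum_(0 <= j < k) (c * z ^+ j)%:E)).
  by apply: lee_sum => j _; exact: tle.
rewrite sumEFin lee_fin.
have := geometric_le_lim k c0 _ (_ : (`|z| < 1)%R).
rewrite /series /geometric /=; apply => //.
by rewrite gtr0_norm.
Qed.

(** On [D] the integrand is dominated by one term of the series of [c j * w] cut off to [S j], and
    the series is integrated termwise. The sets may overlap, so whole balls or superlevel sets can
    stand in for the shells of a dyadic decomposition. *)
Lemma cover_integral_le (D : set T) (S : nat -> set T) (phi w : T -> R)
    (c : nat -> R) :
  measurable D -> (forall j, measurable (S j)) ->
  measurable_fun setT phi -> measurable_fun setT w ->
  (forall y, 0 <= phi y)%R -> (forall y, 0 <= w y)%R -> (forall j, 0 <= c j)%R ->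
  (forall y, D y -> exists j, S j y /\ (phi y <= c j)%R) ->
  \int[mu]_(y in D) (phi y * w y)%:E <=
  \sum_(0 <= j <oo) ((c j)%:E * \int[mu]_(y in S j) (w y)%:E).
Proof.
move=> mD mS mphi mw phi0 w0 c0 cover.
pose f j y := ((c j)%:E * (((EFin \o w) \_ (S j)) y)).
have f0 j y : 0 <= f j y.
  apply: mule_ge0; first by rewrite lee_fin.
  by rewrite patchE; case: ifPn => _ //=; rewrite lee_fin.
have mwS j : measurable_fun setT ((EFin \o w) \_ (S j) : T -> \bar R).
  apply/(measurable_restrictT _ (mS j)).
  by apply: measurable_funTS; exact/measurable_EFinP.
have mf j : measurable_fun setT (f j : T -> \bar R) by exact: measurable_funeM.
apply: (@le_trans _ _ (\int[mu]_(y in D) \sum_(0 <= j <oo) f j y)).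
  apply: ge0_le_integral => //.
  - by move=> y _; rewrite lee_fin mulr_ge0.
  - by apply: measurable_funTS; apply/measurable_EFinP; exact: measurable_funM.
  - apply: measurable_funTS; apply: ge0_emeasurable_sum => //.
  move=> y Dy; have [j [Sjy phic]] := cover y Dy.
  apply: (@le_trans _ _ (f j y)).
    rewrite /f patchE mem_set//= -EFinM lee_fin; exact: ler_wpM2r.
  (* Isolates the term of index [j]; the remaining terms are nonnegative. *)
  rewrite (@nneseries_split _ _ 0 j.+1) //.
  rewrite big_nat_recr//= -addeA addeC -addeA leeDl //.
  by apply: adde_ge0; [exact: nneseries_ge0|exact: sume_ge0].
rewrite integral_nneseries//; last by move=> j; exact: measurable_funTS.
apply: lee_nneseries => j _; first by move=> _; apply: integral_ge0.
rewrite ge0_integralZl_EFin//; last 2 first.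
- by move=> y _; rewrite patchE; case: ifPn => _ //=; rewrite lee_fin.
- exact: measurable_funTS.
apply: lee_wpmul2l; first by rewrite lee_fin.
rewrite [leRHS]integral_mkcond; apply: ge0_subset_integral => //.
by move=> y _; rewrite patchE; case: ifPn => _ //=; rewrite lee_fin.
Qed.

Lemma cover_integral_geometric (D : set T) (S : nat -> set T) (phi w : T -> R)
    (c : nat -> R) (b z : R) :
  measurable D -> (forall j, measurable (S j)) ->
  measurable_fun setT phi -> measurable_fun setT w ->
  (forall y, 0 <= phi y)%R -> (forall y, 0 <= w y)%R -> (forall j, 0 <= c j)%R ->
  (forall y, D y -> exists j, S j y /\ (phi y <= c j)%R) ->
  (0 <= b)%R -> (0 < z < 1)%R ->
  (forall j, (c j)%:E * \int[mu]_(y in S j) (w y)%:E <= (b * z ^+ j)%:E) ->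
  \int[mu]_(y in D) (phi y * w y)%:E <= (b / (1 - z))%:E.
Proof.
move=> mD mS mphi mw phi0 w0 c0 cover b0 z01 bz.
apply: le_trans; first exact: (@cover_integral_le D S phi w c).
apply: nneseries_le_geometric => // j.
by apply: mule_ge0; rewrite ?lee_fin//; apply: integral_ge0 => y _; rewrite lee_fin.
Qed.

(** Dominated convergence with majorant [g]: every point eventually leaves [D k]. It serves for
    superlevel sets at growing levels and for exteriors of growing balls. *)
Lemma integral_vanishing_sets (D : nat -> set T) (g : T -> R) (e : R) :
  (forall k, measurable (D k)) -> measurable_fun setT g -> (forall y, 0 <= g y)%R ->
  \int[mu]_y (g y)%:E < +oo -> (forall y, \forall k \near \oo, ~ D k y) ->
  (0 < e)%R ->
  \forall k \near \oo, \int[mu]_(y in D k) (g y)%:E < e%:E.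
Proof.
move=> mD mg g0 gfin Dout e0.
have ig : mu.-integrable setT (EFin \o g).
  apply/integrableP; split; first exact/measurable_EFinP.
  by under eq_integral do rewrite /= ger0_norm//.
pose h k := (EFin \o g) \_ (D k) : T -> \bar R.
have mh k : measurable_fun setT (h k).
  apply/(measurable_restrictT _ (mD k)).
  by apply: measurable_funTS; exact/measurable_EFinP.
have h0 : {ae mu, forall y, setT y -> h ^~ y @ \oo --> cst 0 y}.
  apply: aeW => y _; apply: cvg_near_cst.
  by apply: filterS (Dout y) => k Dky; rewrite /h patchE memNset.
have hg : {ae mu, forall y k, setT y -> `|h k y| <= (EFin \o g) y}.
  apply: aeW => y k _; rewrite /h patchE; case: ifPn => _ /=.
    by rewrite ger0_norm.
  by rewrite normr0 lee_fin.
have [_ _] := dominated_convergence measurableT mh (measurable_cst _) h0 ig hg.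
rewrite integral0 => cvg0.
have nb : nbhs (0%E : \bar R) [set x | x < e%:E].
  by apply: open_nbhs_nbhs; split; [exact: open_ereal_lt_ereal|rewrite /= lte_fin].
near=> k; rewrite integral_mkcond.
by near: k; exact: (cvg0 _ nb).
Unshelve. all: by end_near.
Qed.

End integral_estimates.

(** * Real powers *)

Section powR_facts.
Context (R : realType).
Implicit Types x y z r s : R.

Lemma powR_addp x r s : 0 < x -> x `^ (r + s) = x `^ r * x `^ s.
Proof. by move=> x0; apply: powRD; apply/implyP => _; rewrite gt_eqF. Qed.

Lemma powR_le x y r : 0 <= r -> 0 <= x -> x <= y -> x `^ r <= y `^ r.
Proof.
by move=> r0 x0 xy; apply: ge0_ler_powR; rewrite // nnegrE// (le_trans x0).
Qed.

Lemma powR_le_anti x y r : r <= 0 -> 0 < x -> x <= y -> y `^ r <= x `^ r.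
Proof.
move=> r0 x0 xy; rewrite -(opprK r) !(powRN _ (- r)).
rewrite lef_pV2 ?posrE ?powR_gt0// ?(lt_le_trans x0)//.
by apply: powR_le => //; rewrite ?oppr_ge0// ltW.
Qed.

Lemma powR_lt_anti x y r : r < 0 -> 0 < x -> x < y -> y `^ r < x `^ r.
Proof.
move=> r0 x0 xy; rewrite -(opprK r) !(powRN _ (- r)).
rewrite ltf_pV2 ?posrE ?powR_gt0// ?(lt_trans x0)//.
by apply: gt0_ltr_powR; rewrite ?oppr_gt0// nnegrE ltW// (lt_trans x0).
Qed.

Lemma powR_itv01 z s : 0 < z < 1 -> 0 < s -> 0 < z `^ s < 1.
Proof.
move=> /andP[z0 z1] s0; rewrite powR_gt0//=.
have -> : (1 : R) = 1 `^ s by rewrite powR1.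
by apply: gt0_ltr_powR; rewrite // nnegrE ltW.
Qed.

Lemma powR_mul_exprn x z s (j : nat) : 0 <= x -> 0 <= z ->
  (x * z ^+ j) `^ s = x `^ s * (z `^ s) ^+ j.
Proof.
move=> x0 z0; rewrite powRM ?exprn_ge0//; congr (_ * _).
by rewrite -(powR_mulrn j z0) -(powR_mulrn j (powR_ge0 z s)) -!powRrM mulrC.
Qed.

Lemma exists_powR_lt (s e : R) : 0 < s -> 0 < e -> exists2 t, 0 < t & t `^ s <= e.
Proof.
move=> s0 e0; exists (e `^ s^-1); first exact: powR_gt0.
by rewrite -powRrM mulVf ?gt_eqF// powRr1// ltW.
Qed.

Lemma exprn_lt_eventually (z e : R) : 0 < z < 1 -> 0 < e ->
  \forall j \near \oo, z ^+ j < e.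
Proof.
move=> /andP[z0 z1] e0.
have /cvgrPdist_lt/(_ _ e0) : (z ^+ j @[j --> \oo] --> (0 : R)).
  by apply: cvg_expr; rewrite gtr0_norm.
apply: filterS => j.
by rewrite sub0r normrN gtr0_norm// exprn_gt0.
Qed.

(** Take the least exponent [k] with [z ^+ k <= t]. It is positive because [t < 1], so it has a
    predecessor, and that one fails the inequality. This locates the scale of [t] in a geometric
    decomposition. *)
Lemma geometric_bracket (z t : R) : 0 < z < 1 -> 0 < t < 1 ->
  exists j : nat, z ^+ j.+1 <= t < z ^+ j.
Proof.
move=> z01 /andP[t0 t1].
have [N _ HN] := exprn_lt_eventually z01 t0.
have ex : exists k, z ^+ k <= t by exists N; apply/ltW/HN => /=.
case: (ex_minnP ex) => -[|j] zj jmin.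
  by move: zj; rewrite expr0 leNgt t1.
exists j; rewrite zj /= ltNge; apply/negP => /jmin.
by rewrite ltnn.
Qed.

End powR_facts.

(** * The Riesz kernel *)

Section riesz_kernel.
Context (R : realType) (n : nat).
Implicit Types x y : n.-tuple R.

Lemma edist_ge0 x y : 0 <= edist x y.
Proof. exact: sqrtr_ge0. Qed.

Lemma edistC x y : edist x y = edist y x.
Proof.
by rewrite /edist; congr (Num.sqrt _); apply: eq_bigr => i _; rewrite -sqrrN opprB.
Qed.

Lemma edist_sqr x y : edist x y ^+ 2 = \sum_(i < n) (tnth x i - tnth y i) ^+ 2.
Proof. by rewrite sqr_sqrtr// sumr_ge0// => i _; rewrite sqr_ge0. Qed.

Lemma enorm_sqr x : enorm x ^+ 2 = \sum_(i < n) tnth x i ^+ 2.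
Proof. by rewrite sqr_sqrtr// sumr_ge0// => i _; rewrite sqr_ge0. Qed.

Lemma edist_coord x y i : `|tnth x i - tnth y i| <= edist x y.
Proof.
rewrite -sqrtr_sqr ler_sqrt; last by rewrite sumr_ge0// => k _; rewrite sqr_ge0.
by rewrite (bigD1 i)//= lerDl sumr_ge0// => k _; rewrite sqr_ge0.
Qed.

(** A substitute for the triangle inequality that works coordinate by coordinate: the difference of
    the two sides is the sum of the squares of [tnth x i - 2 * tnth y i]. *)
Lemma enorm_sqr_le x y : enorm x ^+ 2 <= 2 * edist x y ^+ 2 + 2 * enorm y ^+ 2.
Proof.
rewrite edist_sqr !enorm_sqr !mulr_sumr -big_split/=; apply: ler_sum => i _.
have := sqr_ge0 (tnth x i - 2 * tnth y i); nra.
Qed.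

Lemma measurable_edist2 :
  measurable_fun setT (fun z : n.-tuple R * n.-tuple R => edist z.1 z.2).
Proof.
have -> : (fun z : n.-tuple R * n.-tuple R => edist z.1 z.2) =
    (@powR R)^~ 2^-1 \o (fun z => \sum_(i < n) (tnth z.1 i - tnth z.2 i) ^+ 2).
  apply/funext => z /=; rewrite powR12_sqrt//.
  by apply: sumr_ge0 => i _; exact: sqr_ge0.
apply: measurableT_comp; first exact: measurable_powR.
apply: measurable_sum => i; apply: measurable_funX.
apply: measurable_funB.
- exact: (measurableT_comp (measurable_tnth i) measurable_fst).
- exact: (measurableT_comp (measurable_tnth i) measurable_snd).
Qed.

Lemma measurable_edist x : measurable_fun setT (edist x).
Proof.
exact: (measurableT_comp measurable_edist2 (measurable_pair1 x)).
Qed.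

Lemma measurable_enorm : measurable_fun setT (@enorm R n).
Proof.
have -> : @enorm R n = edist [tuple 0 | _ < n].
  apply/funext => x; rewrite /enorm /edist; congr (Num.sqrt _).
  by apply: eq_bigr => i _; rewrite tnth_mktuple sub0r sqrrN.
exact: measurable_edist.
Qed.

End riesz_kernel.

(* The value of the kernel on the diagonal is [0 `^ (alpha - n) = 0]. *)
Definition kern (R : realType) (n : nat) (alpha : R) (x y : n.-tuple R) : R :=
  edist x y `^ (alpha - n%:R).

(** * Integrals of powers of the distance near and far from a point *)

Section kernel_integrals.
Context (R : realType) (n : nat) (mu : {measure set (n.-tuple R) -> \bar R}).
Hypothesis mu_lebesgue : is_lebesgue_measure_n mu.
Context (alpha : R).
Hypotheses (alpha0 : 0 < alpha) (alphan : alpha < n%:R).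
Implicit Types x y : n.-tuple R.

Local Notation K := (kern alpha).

Lemma kern_ge0 x y : 0 <= K x y.
Proof. exact: powR_ge0. Qed.

Lemma kernC x y : K x y = K y x.
Proof. by rewrite /kern edistC. Qed.

Lemma measurable_kern2 :
  measurable_fun setT (fun z : n.-tuple R * n.-tuple R => K z.1 z.2).
Proof.
apply: (measurableT_comp (f := (@powR R)^~ (alpha - n%:R))).
  exact: measurable_powR.
exact: measurable_edist2.
Qed.

Lemma measurable_kern x : measurable_fun setT (K x).
Proof. exact: (measurableT_comp measurable_kern2 (measurable_pair1 x)). Qed.

Lemma measurable_level_le (f : n.-tuple R -> R) r :
  measurable_fun setT f -> measurable [set y | f y <= r].
Proof. by move=> mf; rewrite -[X in measurable X]setTI; exact: measurable_fun_le. Qed.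

Lemma measurable_level_ge (f : n.-tuple R -> R) r :
  measurable_fun setT f -> measurable [set y | r <= f y].
Proof. by move=> mf; rewrite -[X in measurable X]setTI; exact: measurable_fun_le. Qed.

Lemma measurable_level_lt (f : n.-tuple R -> R) r :
  measurable_fun setT f -> measurable [set y | f y < r].
Proof.
move=> mf; rewrite (_ : [set _ | _] = ~` [set y | r <= f y]).
  by apply: measurableC; exact: measurable_level_ge.
by apply/seteqP; split => y /=; rewrite ltNge => /negP.
Qed.

Lemma measurable_level_gt (f : n.-tuple R -> R) r :
  measurable_fun setT f -> measurable [set y | r < f y].
Proof.
move=> mf; rewrite (_ : [set _ | _] = ~` [set y | f y <= r]).
  by apply: measurableC; exact: measurable_level_le.
by apply/seteqP; split => y /=; rewrite ltNge => /negP.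
Qed.

Lemma measurable_box (a b : n.-tuple R) : measurable (box a b).
Proof.
have -> : box a b = \bigcap_(i in [set: 'I_n])
    ([set x | tnth a i <= tnth x i] `&` [set x | tnth x i <= tnth b i]).
  apply/seteqP; split => [x xab i _|x xab i]; first by split; case/andP: (xab i).
  by apply/andP; have [] := xab i Logic.I.
apply: fin_bigcap_measurable => // i _; apply: measurableI.
- exact: measurable_level_ge (measurable_tnth i).
- exact: measurable_level_le (measurable_tnth i).
Qed.

(** The ball lies in the cube of side [2 * r] with the same centre; only the scaling [r ^+ n]
    matters later. *)
Lemma ball_measure_le x r : 0 <= r ->
  (mu [set y | (edist x y <= r)%R] <= ((2 * r) ^+ n)%:E)%E.
Proof.
move=> r0.
pose a := [tuple tnth x i - r | i < n]; pose b := [tuple tnth x i + r | i < n].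
have -> : (2 * r) ^+ n = \prod_(i < n) (tnth b i - tnth a i).
  rewrite (eq_bigr (fun=> 2 * r)) ?prodr_const ?card_ord// => i _.
  by rewrite !tnth_mktuple; ring.
rewrite -mu_lebesgue => [|i]; last by rewrite !tnth_mktuple; lra.
apply: le_measure; rewrite ?inE.
- exact: measurable_level_le (measurable_edist x).
- exact: measurable_box.
move=> y /= xyr i; rewrite !tnth_mktuple.
by have := le_trans (edist_coord x y i) xyr; rewrite ler_norml; lra.
Qed.

(* The integrals are summed over the dyadic shells of radii [r * z ^+ j]. *)
Let z : R := 2^-1.

Let z01 : 0 < z < 1.
Proof. by rewrite /z invr_gt0 ltr0n invf_lt1 ?ltr1n ?ltr0n. Qed.

Lemma kern_near_integral : exists2 C, 0 < C &
  forall x r, 0 < r ->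
  (\int[mu]_(y in [set y | (edist x y < r)%R]) (K x y)%:E <= (C * r `^ alpha)%:E)%E.
Proof.
have zs := powR_itv01 z01 alpha0.
have /andP[z0 z1] := z01; have zge := ltW z0.
pose C0 : R := 2 ^+ n * z `^ (alpha - n%:R).
exists (C0 / (1 - z `^ alpha)).
  rewrite divr_gt0// ?mulr_gt0 ?powR_gt0//; last by rewrite subr_gt0; case/andP: zs.
move=> x r r0; have rge := ltW r0.
rewrite mulrAC.
(* The constant weight 1 gives the integrand the shape [phi y * w y] of the covering lemma. *)
under eq_integral do rewrite -[X in X%:E]mulr1.
apply: (@cover_integral_geometric _ _ _ mu _ (fun j => [set y | edist x y <= r * z ^+ j])
   _ _ (fun j => (r * z ^+ j.+1) `^ (alpha - n%:R))) => //.
- exact: measurable_level_lt (measurable_edist x).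
- by move=> j; exact: measurable_level_le (measurable_edist x).
- exact: measurable_kern.
- exact: kern_ge0.
- by move=> j; exact: powR_ge0.
- move=> y /= dr; have := edist_ge0 x y; rewrite le_eqVlt => /predU1P[d0|d0].
    (* At [y = x] the kernel takes its default value 0, so the largest ball will do. *)
    exists 0%N; split; first by rewrite -d0 expr0 mulr1.
    by rewrite /kern -d0 powR0 ?powR_ge0// lt_eqF// subr_lt0.
  have /(geometric_bracket z01)[j /andP[jl jr]] : 0 < edist x y / r < 1.
    by rewrite divr_gt0//= ltr_pdivrMr// mul1r.
  exists j; split; first by rewrite mulrC -ler_pdivrMr// ltW.
  apply: powR_le_anti; first by rewrite subr_le0 ltW.
    by rewrite mulr_gt0 ?exprn_gt0.
  by rewrite mulrC -ler_pdivlMr.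
- by rewrite mulr_ge0 ?powR_ge0// mulr_ge0 ?exprn_ge0 ?powR_ge0.
- move=> j; rewrite integral_cst//; last exact: measurable_level_le (measurable_edist x).
  rewrite mul1e; apply: (@le_trans _ _
    (((r * z ^+ j.+1) `^ (alpha - n%:R))%:E * ((2 * (r * z ^+ j)) ^+ n)%:E)%E).
    apply: lee_wpmul2l; first by rewrite lee_fin powR_ge0.
    by apply: ball_measure_le; rewrite mulr_ge0 ?exprn_ge0.
  rewrite -EFinM lee_fin (_ : r * z ^+ j.+1 = r * z ^+ j * z); last by rewrite exprSr mulrA.
  rewrite powRM ?mulr_ge0 ?exprn_ge0// exprMn.
  have p0 : 0 < r * z ^+ j by rewrite mulr_gt0 ?exprn_gt0.
  rewrite -(powR_mulrn n (ltW p0)) [X in X <= _](_ : _ = C0 *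
    ((r * z ^+ j) `^ (alpha - n%:R) * (r * z ^+ j) `^ n%:R)); last by rewrite /C0; ring.
  by rewrite -powR_addp// subrK powR_mul_exprn// mulrA.
Qed.

Lemma dist_far_integral a : 0 < a -> exists2 C, 0 < C &
  forall x r, 0 < r ->
  (\int[mu]_(y in [set y | (r <= edist x y)%R]) (edist x y `^ (- n%:R - a))%:E
     <= (C * r `^ (- a))%:E)%E.
Proof.
move=> a0.
have zs := powR_itv01 z01 a0.
have /andP[z0 z1] := z01; have zge := ltW z0.
pose C0 : R := 2 ^+ n * z `^ (- n%:R - a).
exists (C0 / (1 - z `^ a)).
  rewrite divr_gt0// ?mulr_gt0 ?powR_gt0//; last by rewrite subr_gt0; case/andP: zs.
move=> x r r0; have rge := ltW r0.
rewrite mulrAC.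
under eq_integral do rewrite -[X in X%:E]mulr1.
have mdist : measurable_fun setT (fun y => edist x y `^ (- n%:R - a)).
  apply: (measurableT_comp (f := (@powR R)^~ (- n%:R - a))).
    exact: measurable_powR.
  exact: measurable_edist.
apply: (@cover_integral_geometric _ _ _ mu _ (fun j => [set y | edist x y <= r / z ^+ j])
   _ _ (fun j => (r / z ^+ j * z) `^ (- n%:R - a))) => //.
- exact: measurable_level_ge (measurable_edist x).
- by move=> j; exact: measurable_level_le (measurable_edist x).
- by move=> j; exact: powR_ge0.
- by move=> j; exact: powR_ge0.
- move=> y /= rd; have d0 := lt_le_trans r0 rd.
  (* The ratio [r / edist x y] may equal 1; the extra factor [z] makes it strictly smaller, as the
     bracketing requires, and shifts the index by one. *)
  have t01 : 0 < r / edist x y * z < 1.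
    rewrite mulr_gt0 ?divr_gt0//=; apply: le_lt_trans z1.
    by rewrite ler_piMl// ler_pdivrMr// mul1r.
  have [j /andP[jl jr]] := geometric_bracket z01 t01.
  have zj0 : 0 < z ^+ j :> R by rewrite exprn_gt0.
  exists j; split.
    rewrite ler_pdivlMr// mulrC -ler_pdivlMr//.
    by move: jl; rewrite exprS mulrC ler_pM2r.
  apply: powR_le_anti; first by rewrite -opprD oppr_le0 addr_ge0// ltW.
    by rewrite mulr_gt0 ?divr_gt0.
  rewrite mulrAC ler_pdivrMr// [edist x y * _]mulrC -ler_pdivrMr//.
  by rewrite mulrAC ltW.
- by rewrite mulr_ge0 ?powR_ge0// mulr_ge0 ?exprn_ge0 ?powR_ge0.
- move=> j; rewrite integral_cst//; last exact: measurable_level_le (measurable_edist x).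
  have zj0 : 0 < z ^+ j :> R by rewrite exprn_gt0.
  have p0 : 0 < r / z ^+ j by rewrite divr_gt0.
  rewrite mul1e; apply: (@le_trans _ _
    (((r / z ^+ j * z) `^ (- n%:R - a))%:E * ((2 * (r / z ^+ j)) ^+ n)%:E)%E).
    apply: lee_wpmul2l; first by rewrite lee_fin powR_ge0.
    by apply: ball_measure_le; exact: ltW.
  rewrite -EFinM lee_fin (powRM _ (ltW p0) zge) exprMn.
  rewrite -(powR_mulrn n (ltW p0)) [X in X <= _](_ : _ = C0 *
    ((r / z ^+ j) `^ (- n%:R - a) * (r / z ^+ j) `^ n%:R)); last by rewrite /C0; ring.
  rewrite -powR_addp// (_ : - n%:R - a + n%:R = - a); last by ring.
  rewrite -[leRHS]mulrA ler_pM2l ?mulr_gt0 ?powR_gt0 ?exprn_gt0//.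
  rewrite powRM// ?invr_ge0 ?exprn_ge0//.
  rewrite -(powR_mulrn j (ltW z0)) -powR_inv1 ?powR_ge0//.
  by rewrite -(powR_mulrn j (powR_ge0 z a)) -!powRrM mulN1r opprK [j%:R * _]mulrC.
Qed.

End kernel_integrals.

Lemma ge0_integral_setID d (T : measurableType d) (R : realType)
    (mu : {measure set T -> \bar R}) (D B : set T) (f : T -> \bar R) :
  measurable D -> measurable B -> measurable_fun setT f ->
  (forall y, 0 <= f y)%E ->
  (\int[mu]_(y in D) f y =
   \int[mu]_(y in D `&` B) f y + \int[mu]_(y in D `\` B) f y)%E.
Proof.
move=> mD mB mf f0; rewrite -{1}(setUIDK D B) ge0_integral_setU//.
- exact: measurableI.
- exact: measurableD.
- exact: measurable_funTS.
- by apply/disj_setPS => y [[_ By] [_ /(_ By)]].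
Qed.

Lemma powR_le_add (R : realType) (x t q s : R) : 0 <= q <= s -> 0 < t -> 0 <= x ->
  x `^ q <= t `^ q + t `^ (q - s) * x `^ s.
Proof.
move=> /andP[q0 qs] t0 x0; have [xt|tx] := leP x t.
  by rewrite (le_trans (powR_le q0 x0 xt))// lerDl mulr_ge0// powR_ge0.
have xp := lt_trans t0 tx.
have -> : x `^ q = x `^ (q - s) * x `^ s by rewrite -powR_addp// subrK.
apply: (@le_trans _ _ (t `^ (q - s) * x `^ s)); last by rewrite lerDr powR_ge0.
by rewrite ler_wpM2r ?powR_ge0// powR_le_anti// ?subr_le0// ltW.
Qed.

(** * Riesz potentials *)

Section potential_estimates.
Context (R : realType) (n : nat) (mu : {measure set (n.-tuple R) -> \bar R}).
Hypothesis mu_lebesgue : is_lebesgue_measure_n mu.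
Context (alpha : R).
Hypotheses (alpha0 : 0 < alpha) (alphan : alpha < n%:R).
Implicit Types x y : n.-tuple R.
Implicit Types f : n.-tuple R -> R.

Local Notation K := (kern alpha).
Local Notation Bl x r := [set y | (edist x y < r)%R].

Lemma measurable_powR_fun f s :
  measurable_fun setT f -> measurable_fun setT (fun y => f y `^ s).
Proof. by move=> mf; exact: measurableT_comp (measurable_powR s) mf. Qed.

Lemma measurable_potential f q x : measurable_fun setT f ->
  measurable_fun setT (fun y => f y `^ q * K x y).
Proof.
by move=> mf; apply: measurable_funM; [exact: measurable_powR_fun|exact: measurable_kern].
Qed.

Lemma measurable_ball x r : measurable (Bl x r).
Proof. exact: measurable_level_lt (measurable_edist x). Qed.

Lemma kern_set_integral : exists2 C, 0 < C &
  forall (E : set (n.-tuple R)) x s, measurable E -> 0 < s ->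
  (\int[mu]_(y in E) (K x y)%:E <=
   (C * s `^ alpha)%:E + (s `^ (alpha - n%:R))%:E * mu E)%E.
Proof.
have [C C0 HC] := kern_near_integral mu_lebesgue alpha0 alphan.
exists C => // E x s mE s0.
have mB := measurable_ball x s.
have mK : measurable_fun setT (EFin \o K x).
  by apply/measurable_EFinP; exact: measurable_kern.
rewrite (ge0_integral_setID _ mE mB mK) => [|y]; last by rewrite lee_fin kern_ge0.
apply: leeD.
  apply: le_trans (HC x s s0); apply: ge0_subset_integral => //.
  - exact: measurableI.
  - exact: measurable_funTS.
  - by move=> y _; rewrite lee_fin kern_ge0.
apply: (@le_trans _ _ (\int[mu]_(y in E) (cst (s `^ (alpha - n%:R))%:E) y)%E).
  apply: (@le_trans _ _
    (\int[mu]_(y in E `\` Bl x s) (s `^ (alpha - n%:R))%:E)%E).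
    apply: ge0_le_integral => //.
    - exact: measurableD.
    - by move=> y _; rewrite lee_fin kern_ge0.
    - exact: measurable_funTS.
    - move=> y [_ /= /negP]; rewrite -leNgt => sd; rewrite lee_fin.
      by apply: powR_le_anti => //; rewrite subr_le0 ltW.
  apply: ge0_subset_integral => //; first exact: measurableD.
  by move=> y _; rewrite lee_fin powR_ge0.
by rewrite integral_cst.
Qed.

Section bound.
Context (a b q : R).
Hypotheses (a0 : 0 < a) (b0 : 0 < b) (q0 : 0 < q).
Hypotheses (bq : b * q = a + alpha) (bqn : b * q < n%:R).

Lemma far_potential_le f x y r sg : 0 <= f y -> 0 < r -> 0 < sg ->
  r <= edist x y ->
  f y `^ q * K x y <= sg `^ q * edist x y `^ (- n%:R - a) +
    sg `^ (q - n%:R / b) * r `^ (- a) * f y `^ (n%:R / b).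
Proof.
move=> f0 r0 sg0 rd; have d0 := lt_le_trans r0 rd.
set d := edist x y in rd d0 *.
have qs : 0 <= q <= n%:R / b by rewrite ltW//= ler_pdivlMr// mulrC ltW.
have t0 : 0 < sg * d `^ (- b) by rewrite mulr_gt0 ?powR_gt0.
have := powR_le_add qs t0 f0.
rewrite !powRM ?powR_ge0 ?(ltW sg0)// => H.
apply: (le_trans (ler_wpM2r (kern_ge0 alpha x y) H)).
rewrite mulrDl -/d /kern -/d -!powRrM.
have -> : sg `^ q * d `^ (- b * q) * d `^ (alpha - n%:R) = sg `^ q * d `^ (- n%:R - a).
  by rewrite -mulrA -powR_addp// mulNr bq; congr (_ * _ `^ _); ring.
apply: lerD => //.
have -> : sg `^ (q - n%:R / b) * d `^ (- b * (q - n%:R / b)) * f y `^ (n%:R / b)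
    * d `^ (alpha - n%:R) = sg `^ (q - n%:R / b) * f y `^ (n%:R / b) * d `^ (- a).
  rewrite mulrAC -[X in X * _ = _]mulrA -powR_addp// [in RHS]mulrAC.
  congr (_ * _ `^ _ * _); rewrite mulrBr mulNr bq.
  by field; rewrite gt_eqF.
rewrite mulrAC ler_wpM2r ?powR_ge0// ler_wpM2l ?powR_ge0//.
by rewrite powR_le_anti// oppr_le0 ltW.
Qed.

(** Inside the ball of radius [r] the bound [m] is used, outside it [far_potential_le]. The
    parameters [m], [r], [sg] and [N] stay explicit, since the lemma serves both for scale-invariant
    bounds and for smallness at infinity. *)
Lemma potential_le : exists2 C, 0 < C &
  forall (A : set (n.-tuple R)) f m N x r sg, measurable A -> measurable_fun setT f ->
  (forall y, 0 <= f y) -> 0 <= m -> (forall y, A y -> f y <= m) ->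
  (\int[mu]_(y in A) (f y `^ (n%:R / b))%:E <= N%:E)%E -> 0 < r -> 0 < sg ->
  (\int[mu]_(y in A) (f y `^ q * K x y)%:E <=
   (C * (m `^ q * r `^ alpha + sg `^ q * r `^ (- a))
     + sg `^ (q - n%:R / b) * N * r `^ (- a))%:E)%E.
Proof.
have [C1 C10 HC1] := kern_near_integral mu_lebesgue alpha0 alphan.
have [C2 C20 HC2] := dist_far_integral mu_lebesgue a0.
exists (C1 + C2); first exact: addr_gt0.
move=> A f m N x r sg mA mf f0 m0 fm fN r0 sg0.
have mB := measurable_ball x r.
have mF : measurable_fun setT (fun y => (f y `^ q * K x y)%:E).
  by apply/measurable_EFinP; exact: measurable_potential.
have F0 y : (0 <= (f y `^ q * K x y)%:E)%E by rewrite lee_fin mulr_ge0 ?powR_ge0.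
rewrite (ge0_integral_setID _ mA mB mF)//.
have near : (\int[mu]_(y in A `&` Bl x r) (f y `^ q * K x y)%:E
    <= (C1 * (m `^ q * r `^ alpha))%:E)%E.
  apply: (@le_trans _ _ (\int[mu]_(y in A `&` Bl x r)
     ((m `^ q)%:E * (K x y)%:E))%E).
    apply: ge0_le_integral => //.
    - exact: measurableI.
    - exact: measurable_funTS.
    - apply: measurable_funTS; apply: measurable_funeM; apply/measurable_EFinP.
      exact: measurable_kern.
    - move=> y [Ay _]; rewrite -EFinM lee_fin ler_wpM2r ?kern_ge0//.
      by apply: powR_le; rewrite ?fm// ltW.
  have mK : measurable_fun setT (EFin \o K x).
    by apply/measurable_EFinP; exact: measurable_kern.
  rewrite ge0_integralZl_EFin ?powR_ge0//; last 3 first.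
  - exact: measurableI.
  - by move=> y _; rewrite lee_fin kern_ge0.
  - exact: measurable_funTS.
  rewrite mulrCA EFinM; apply: lee_wpmul2l; first by rewrite lee_fin powR_ge0.
  apply: le_trans (HC1 x r r0); apply: ge0_subset_integral => //.
  - exact: measurableI.
  - exact: measurable_funTS.
  - by move=> y _; rewrite lee_fin kern_ge0.
have far : (\int[mu]_(y in A `\` Bl x r) (f y `^ q * K x y)%:E
    <= (C2 * (sg `^ q * r `^ (- a)) + sg `^ (q - n%:R / b) * N * r `^ (- a))%:E)%E.
  have mD : measurable (A `\` Bl x r) by exact: measurableD.
  have mG1 : measurable_fun setT (fun y => (edist x y `^ (- n%:R - a))%:E).
    by apply/measurable_EFinP; apply: measurable_powR_fun; exact: measurable_edist.
  have mG2 : measurable_fun setT (fun y => (f y `^ (n%:R / b))%:E).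
    by apply/measurable_EFinP; exact: measurable_powR_fun.
  have k0 : 0 <= sg `^ (q - n%:R / b) * r `^ (- a) by rewrite mulr_ge0 ?powR_ge0.
  apply: (@le_trans _ _ (\int[mu]_(y in A `\` Bl x r)
     ((sg `^ q)%:E * (edist x y `^ (- n%:R - a))%:E +
      (sg `^ (q - n%:R / b) * r `^ (- a))%:E * (f y `^ (n%:R / b))%:E))%E).
    apply: ge0_le_integral => //.
    - exact: measurable_funTS.
    - apply: measurable_funTS; apply: emeasurable_funD; exact: measurable_funeM.
    - move=> y [_ /= /negP]; rewrite -leNgt => rd.
      by rewrite -!EFinM -EFinD lee_fin; exact: far_potential_le.
  rewrite ge0_integralD//; last 4 first.
  - by move=> y _; rewrite -EFinM lee_fin mulr_ge0 ?powR_ge0.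
  - by apply: measurable_funTS; exact: measurable_funeM.
  - by move=> y _; rewrite -EFinM lee_fin mulr_ge0 ?powR_ge0.
  - by apply: measurable_funTS; exact: measurable_funeM.
  rewrite !ge0_integralZl_EFin ?powR_ge0//; last 4 first.
  - by move=> y _; rewrite lee_fin powR_ge0.
  - exact: measurable_funTS.
  - by move=> y _; rewrite lee_fin powR_ge0.
  - exact: measurable_funTS.
  rewrite EFinD; apply: leeD.
    rewrite mulrCA EFinM; apply: lee_wpmul2l; first by rewrite lee_fin powR_ge0.
    apply: le_trans (HC2 x r r0); apply: ge0_subset_integral => //.
    - exact: measurable_level_ge (measurable_edist x).
    - exact: measurable_funTS.
    - by move=> y _; rewrite lee_fin powR_ge0.
    - by move=> y [_ /= /negP]; rewrite -leNgt.
  rewrite (mulrAC _ N) [leRHS]EFinM; apply: lee_wpmul2l; first by rewrite lee_fin.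
  apply: le_trans fN; apply: ge0_subset_integral => //.
  - exact: measurable_funTS.
  - by move=> y _; rewrite lee_fin powR_ge0.
apply: (le_trans (leeD near far)); rewrite -EFinD lee_fin.
rewrite addrA lerD2r mulrDl !mulrDr.
have p1 : 0 <= C1 * (sg `^ q * r `^ (- a)) by rewrite !mulr_ge0 ?powR_ge0// ltW.
have p2 : 0 <= C2 * (m `^ q * r `^ alpha) by rewrite !mulr_ge0 ?powR_ge0// ltW.
by lra.
Qed.

End bound.
End potential_estimates.

(** * Tonelli's theorem and duality with the kernel *)

Lemma tonelli_swap d (T : measurableType d) (R : realType)
    (mu : {measure set T -> \bar R}) (f : T * T -> \bar R) :
  sigma_finite setT mu -> measurable_fun setT f -> (forall z, 0 <= f z)%E ->
  [/\ measurable_fun setT (fun x => \int[mu]_y f (x, y))%E,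
      measurable_fun setT (fun y => \int[mu]_x f (x, y))%E &
      (\int[mu]_x \int[mu]_y f (x, y) = \int[mu]_y \int[mu]_x f (x, y))%E].
Proof.
move=> sf mf f0.
(* The measure [mu] is equipped locally with its sigma-finite structure, so that the product-measure
   theorems apply to it. *)
pose H1 := @isSFinite.Build d T R mu (sfinite_measure_sigma_finite sf).
pose H2 := @isSigmaFinite.Build d T R mu sf.
pose nu := HB.pack_for (sigma_finite_measure T R) (Measure.sort mu) H1 H2.
split.
- exact: (@measurable_fun_fubini_tonelli_F _ _ T T R nu f).
- exact: (@measurable_fun_fubini_tonelli_G _ _ T T R nu f).
- exact: (@fubini_tonelli _ _ T T R nu nu f).
Qed.

Section level_sets.
Context (R : realType) (n : nat) (mu : {measure set (n.-tuple R) -> \bar R}).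
Hypothesis mu_lebesgue : is_lebesgue_measure_n mu.
Context (alpha : R).
Hypotheses (alpha0 : 0 < alpha) (alphan : alpha < n%:R).
Implicit Types x y : n.-tuple R.
Implicit Types f : n.-tuple R -> R.

Local Notation K := (kern alpha).

Lemma lebesgue_sigma_finite : sigma_finite [set: n.-tuple R] mu.
Proof.
pose o := [tuple (0 : R) | _ < n].
exists (fun k => [set y | edist o y <= k%:R]).
  apply/seteqP; split => // y _.
  exists (Num.truncn (edist o y)).+1 => //=.
  by rewrite ltW// truncnS_gt.
move=> k; split; first exact: measurable_level_le (measurable_edist o).
exact: le_lt_trans (ball_measure_le mu_lebesgue o (ler0n _ k)) (ltry _).
Qed.

(** Integrate the lower bound [lam] over [E] and exchange the integrals. By symmetry of the kernel
    the inner integral is then that of [K y] over [E], which is at most [c]. *)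
Lemma tonelli_kern_le (E F : set (n.-tuple R)) f lam c :
  measurable E -> measurable F -> measurable_fun setT f -> (forall y, 0 <= f y) ->
  0 <= lam -> 0 <= c ->
  (forall x, E x -> (lam%:E <= \int[mu]_(y in F) (f y * K x y)%:E)%E) ->
  (forall y, (\int[mu]_(x in E) (K y x)%:E <= c%:E)%E) ->
  (lam%:E * mu E <= c%:E * \int[mu]_(y in F) (f y)%:E)%E.
Proof.
move=> mE mF mf f0 lam0 c0 lamE Kc.
(* Both restrictions go into the integrand as indicators, so that the exchange takes place over the
   whole product space. *)
pose G (z : n.-tuple R * n.-tuple R) : \bar R :=
  (\1_E z.1 * (\1_F z.2 * f z.2 * K z.1 z.2))%:E.
have mG : measurable_fun setT G.
  apply/measurable_EFinP; apply: measurable_funM.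
    apply: measurableT_comp measurable_fst.
    exact: measurable_indic.
  apply: measurable_funM; last exact: measurable_kern2.
  apply: (measurableT_comp (f := fun y => \1_F y * f y)) measurable_snd.
  by apply: measurable_funM => //; exact: measurable_indic.
have G0 z : (0 <= G z)%E.
  by rewrite lee_fin !mulr_ge0 ?powR_ge0.
have GE x y : G (x, y) = (((\1_E x)%:E * (\1_F y * f y * K x y)%:E))%E.
  by rewrite EFinM.
have m1 x : measurable_fun setT (fun y => (\1_F y * f y * K x y)%:E).
  apply/measurable_EFinP; apply: measurable_funM; last exact: measurable_kern.
  by apply: measurable_funM => //; exact: measurable_indic.
have lower x : E x -> (lam%:E <= \int[mu]_y G (x, y))%E.
  move=> Ex; apply: le_trans (lamE x Ex) _.
  rewrite integral_mkcond; apply: ge0_le_integral; first exact: measurableT.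
  - move=> y _; apply: erestrict_ge0 => w _; rewrite lee_fin.
    exact: mulr_ge0 (f0 w) (kern_ge0 alpha x w).
  - apply/(measurable_restrictT _ mF); apply: measurable_funTS; apply/measurable_EFinP.
    by apply: measurable_funM; [exact: mf|exact: measurable_kern].
  - exact: measurableT_comp mG (measurable_pair1 x).
  - move=> y _; rewrite GE indicE mem_set// mul1e patchE indicE.
    by case: ifPn => yF; rewrite lee_fin ?mul1r// !mul0r.
have upper y : (\int[mu]_x G (x, y) <= c%:E * (\1_F y * f y)%:E)%E.
  have -> : (\int[mu]_x G (x, y) =
      \int[mu]_(x in E) ((\1_F y * f y)%:E * (K y x)%:E))%E.
    rewrite [RHS]integral_mkcond; apply: eq_integral => x _.
    rewrite GE patchE indicE (kernC _ y); case: ifPn => _; first by rewrite mul1e EFinM.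
    by rewrite mul0e.
  have mKy : measurable_fun setT (EFin \o K y).
    by apply/measurable_EFinP; exact: measurable_kern.
  rewrite ge0_integralZl_EFin ?mulr_ge0//; last 2 first.
  - by move=> x _; rewrite lee_fin kern_ge0.
  - exact: measurable_funTS.
  rewrite muleC; apply: lee_wpmul2r; last exact: Kc.
  by rewrite lee_fin mulr_ge0.
have mFf : measurable_fun setT (fun y => (\1_F y * f y)%:E).
  apply/measurable_EFinP; apply: measurable_funM; last exact: mf.
  exact: measurable_indic.
have -> : (c%:E * \int[mu]_(y in F) (f y)%:E = \int[mu]_y (c%:E * (\1_F y * f y)%:E))%E.
  rewrite ge0_integralZl_EFin//; last by move=> y _; rewrite lee_fin mulr_ge0.
  congr (_ * _)%E; rewrite [LHS]integral_mkcond.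
  apply: eq_integral => y _; rewrite patchE indicE.
  by case: ifPn => _; rewrite ?mul1r ?mul0r.
have [mGF mGG swap] := tonelli_swap lebesgue_sigma_finite mG G0.
apply: (@le_trans _ _ (\int[mu]_x \int[mu]_y G (x, y))%E).
  rewrite -(integral_cst mu mE) [leLHS]integral_mkcond.
  apply: ge0_le_integral; first exact: measurableT.
  - by move=> x _; apply: erestrict_ge0 => w _; rewrite /= lee_fin.
  - by apply/(measurable_restrictT _ mE); exact: measurable_cst.
  - exact: mGF.
  - move=> x _; rewrite patchE; case: ifPn => [xE|_]; last exact: integral_ge0.
    exact: lower (set_mem xE).
rewrite swap; apply: ge0_le_integral; first exact: measurableT.
- by move=> y _; exact: integral_ge0.
- exact: mGG.
- exact: measurable_funeM.
- by move=> y _; exact: upper.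
Qed.

End level_sets.

(** * Decay of level sets *)

Lemma level_cover (R : realType) (b q r rho t : R) :
  0 < b -> 0 < q -> 0 < r -> 0 < rho < 1 -> r `^ (- b) < t ->
  exists j : nat, (r * rho ^+ j) `^ (- b) < t /\
                  t `^ q <= (r * rho ^+ j.+1) `^ (- (b * q)).
Proof.
move=> b0 q0 r0 rho01 rt.
have rb0 : 0 < r `^ (- b) by exact: powR_gt0.
have t0 := lt_trans rb0 rt.
have powbK s : 0 < s -> (s `^ (- b)) `^ (- b^-1) = s.
  by move=> s0; rewrite -powRrM mulrNN mulfV ?gt_eqF// powRr1// ltW.
have powbVK s : 0 < s -> (s `^ (- b^-1)) `^ (- b) = s.
  by move=> s0; rewrite -powRrM mulrNN mulVf ?gt_eqF// powRr1// ltW.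
have tb0 : 0 < t `^ (- b^-1) by exact: powR_gt0.
have s01 : 0 < t `^ (- b^-1) / r < 1.
  rewrite divr_gt0//= ltr_pdivrMr// mul1r -[ltRHS](powbK r r0).
  by apply: powR_lt_anti; rewrite ?oppr_lt0 ?invr_gt0.
have rho0 : 0 < rho by case/andP: rho01.
have [j /andP[jl jr]] := geometric_bracket rho01 s01.
exists j; split.
  rewrite -[ltRHS](powbVK t t0); apply: powR_lt_anti; rewrite ?oppr_lt0//.
  by rewrite mulrC -ltr_pdivrMr.
rewrite -mulNr powRrM; apply: powR_le; [exact: ltW|exact: ltW|].
rewrite -[leLHS](powbVK t t0); apply: powR_le_anti.
- by rewrite oppr_le0 ltW.
- by rewrite mulr_gt0 ?exprn_gt0.
- by rewrite mulrC -ler_pdivlMr.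
Qed.

Section level_decay.
Context (R : realType) (n : nat) (mu : {measure set (n.-tuple R) -> \bar R}).
Hypothesis mu_lebesgue : is_lebesgue_measure_n mu.
Context (alpha : R).
Hypotheses (alpha0 : 0 < alpha) (alphan : alpha < n%:R).
Context (a b q : R).
Hypotheses (a0 : 0 < a) (b0 : 0 < b) (q0 : 0 < q).
Hypotheses (bq : b * q = a + alpha) (bqn : b * q < n%:R).
Context (f u : n.-tuple R -> R) (N : R).
Hypotheses (mf : measurable_fun setT f) (f0 : forall y, 0 <= f y).
Hypotheses (mu_u : measurable_fun setT u).
Hypothesis fN : (\int[mu]_y (f y `^ (n%:R / b))%:E <= N%:E)%E.
Hypothesis u_le :
  forall x, ((u x)%:E <= \int[mu]_y (f y `^ q * kern alpha x y)%:E)%E.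
Implicit Types x y : n.-tuple R.

Local Notation K := (kern alpha).

Let N0 : 0 <= N.
Proof.
by rewrite -lee_fin (le_trans _ fN)// integral_ge0// => y _; rewrite lee_fin powR_ge0.
Qed.

Lemma potential_large : exists2 rho0, 0 < rho0 &
  forall rho r x, 0 < rho <= rho0 -> 0 < r -> (rho * r) `^ (- a) < u x ->
  (((rho * r) `^ (- a) / 2)%:E <=
     \int[mu]_(y in [set y | (r `^ (- b) < f y)%R]) (f y `^ q * K x y)%:E)%E.
Proof.
have [C C0 HC] := potential_le mu_lebesgue alpha0 alphan a0 b0 q0 bq bqn.
pose M := 2 * (C * 2 + N).
have M0 : 0 < M by rewrite mulr_gt0// ltr_wpDr// mulr_gt0.
exists (M `^ (- a^-1)); first exact: powR_gt0.
move=> rho r x /andP[rho0 rhole] r0 xu.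
have ra0 : 0 < r `^ (- a) by exact: powR_gt0.
have rhoM : M <= rho `^ (- a).
  have -> : M = (M `^ (- a^-1)) `^ (- a).
    by rewrite -powRrM mulrNN mulVf ?gt_eqF// powRr1// ltW.
  by apply: (powR_le_anti _ rho0 rhole); rewrite oppr_le0 ltW.
have mS : measurable [set y | f y <= r `^ (- b)] by exact: measurable_level_le.
have mS' : measurable [set y | r `^ (- b) < f y] by exact: measurable_level_gt.
have mF : measurable_fun setT (fun y => (f y `^ q * K x y)%:E).
  by apply/measurable_EFinP; exact: measurable_potential.
have F0 y : (0 <= (f y `^ q * K x y)%:E)%E by rewrite lee_fin mulr_ge0 ?powR_ge0.
have small : (\int[mu]_(y in [set y | (f y <= r `^ (- b))%R]) (f y `^ q * K x y)%:E
    <= ((C * 2 + N) * r `^ (- a))%:E)%E.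
  (* Here [m] is [r]^ (- b)[and]sg[is 1, so that all terms scale like]r [^ (- a)]. *)
  have -> : (C * 2 + N) * r `^ (- a) =
      C * ((r `^ (- b)) `^ q * r `^ alpha + 1 `^ q * r `^ (- a))
      + 1 `^ (q - n%:R / b) * N * r `^ (- a).
    rewrite -powRrM -powR_addp// !powR1 !mul1r.
    by rewrite (_ : - b * q + alpha = - a); [ring|rewrite mulNr bq; ring].
  apply: HC => //; first exact: powR_ge0.
  apply: le_trans fN; apply: ge0_subset_integral => //.
    by apply/measurable_EFinP; exact: measurable_powR_fun.
  by move=> y _; rewrite lee_fin powR_ge0.
have := u_le x.
rewrite (ge0_integral_setID _ measurableT mS mF)// setTI.
have -> : [set: n.-tuple R] `\` [set y | f y <= r `^ (- b)] = [set y | r `^ (- b) < f y].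
  by apply/seteqP; split => y /=; [case=> _ /negP; rewrite -ltNge|rewrite ltNge => /negP].
set I1 := (X in (_ <= X + _)%E).
set I2 := (\int[mu]_(y in [set y | (r `^ (- b) < f y)%R]) _)%E => uI.
have : ((u x)%:E <= ((C * 2 + N) * r `^ (- a))%:E + I2)%E.
  by apply: le_trans uI _; apply: leeD.
(* The high part is not known to be finite; if it is infinite, the claim is trivial. *)
case: I2 {uI} => [i2||]; [|by move=> _; rewrite leey|by rewrite addeNy leeNy_eq].
rewrite -EFinD !lee_fin.
have : (C * 2 + N) * r `^ (- a) <= (rho * r) `^ (- a) / 2.
  rewrite (powRM _ (ltW rho0) (ltW r0)) mulrAC; apply: ler_wpM2r; first exact: ltW.
  by rewrite ler_pdivlMr// mulrC.
by move: xu; lra.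
Qed.

(** By [level_cover], slice [j] contributes at most [(r * rho ^+ j.+1)]^ (- (b * q))[times]beta * (r
    * rho ^+ j) ^+ n[. The ratio]rho [^ (n%:R - b * q)] is below 1 because [b * q < n]. *)
Lemma layer_cake rho : 0 < rho < 1 -> exists2 C, 0 < C &
  forall r beta, 0 < r -> 0 <= beta ->
  (forall j : nat, (mu [set y | ((r * rho ^+ j) `^ (- b) < f y)%R]
      <= (beta * (r * rho ^+ j) ^+ n)%:E)%E) ->
  (\int[mu]_(y in [set y | (r `^ (- b) < f y)%R]) (f y `^ q)%:E
     <= (C * beta * r `^ (n%:R - b * q))%:E)%E.
Proof.
move=> rho01; have /andP[rho0 rho1] := rho01.
have nbq : 0 < n%:R - b * q by rewrite subr_gt0.
have zs := powR_itv01 rho01 nbq.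
exists (rho `^ (- (b * q)) / (1 - rho `^ (n%:R - b * q))).
  by rewrite divr_gt0 ?powR_gt0// subr_gt0; case/andP: zs.
move=> r beta r0 beta0 levels.
under eq_integral do rewrite -[X in X%:E]mulr1.
rewrite [X in (_ <= X%:E)%E](_ : _ = rho `^ (- (b * q)) * beta * r `^ (n%:R - b * q) /
  (1 - rho `^ (n%:R - b * q))); last by ring.
apply: (@cover_integral_geometric _ _ _ mu _
   (fun j => [set y | (r * rho ^+ j) `^ (- b) < f y]) _ _
   (fun j => (r * rho ^+ j.+1) `^ (- (b * q)))) => //.
- exact: measurable_level_gt.
- by move=> j; exact: measurable_level_gt.
- exact: measurable_powR_fun.
- by move=> y; exact: powR_ge0.
- by move=> j; exact: powR_ge0.
- by move=> y /= rf; exact: level_cover.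
- by rewrite !mulr_ge0 ?powR_ge0.
- move=> j; rewrite integral_cst//; last exact: measurable_level_gt.
  rewrite mul1e; apply: (@le_trans _ _ (((r * rho ^+ j.+1) `^ (- (b * q)))%:E *
     (beta * (r * rho ^+ j) ^+ n)%:E)%E).
    by apply: lee_wpmul2l; rewrite ?lee_fin ?powR_ge0.
  rewrite -EFinM lee_fin (_ : r * rho ^+ j.+1 = r * rho ^+ j * rho); last first.
    by rewrite exprSr mulrA.
  have p0 : 0 < r * rho ^+ j by rewrite mulr_gt0 ?exprn_gt0.
  rewrite (powRM _ (ltW p0) (ltW rho0)) -(powR_mulrn n (ltW p0)).
  rewrite [leLHS](_ : _ = rho `^ (- (b * q)) * beta *
    ((r * rho ^+ j) `^ (n%:R) * (r * rho ^+ j) `^ (- (b * q)))); last by ring.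
  by rewrite -powR_addp// (powR_mul_exprn _ _ (ltW r0) (ltW rho0)) mulrA.
Qed.

Hypothesis u_fin : forall t, 0 < t -> (mu [set y | (t < u y)%R] < +oo)%E.

(* The factor [eps] is arbitrary because the estimate behind it is superlinear in
   [beta]: splitting the potential of the indicator of the level set of [u] at radius
   [tau * r] gains [tau `^ alpha], at the cost of requiring [beta] to be small. *)
Lemma level_improve : exists2 rho0, 0 < rho0 &
  forall rho, 0 < rho <= rho0 -> rho < 1 -> forall eps, 0 < eps ->
  exists2 eta, 0 < eta & forall r beta, 0 < r -> 0 <= beta <= eta ->
  (forall j : nat, (mu [set y | ((r * rho ^+ j) `^ (- b) < f y)%R]
      <= (beta * (r * rho ^+ j) ^+ n)%:E)%E) ->
  (mu [set y | ((rho * r) `^ (- a) < u y)%R] <= (eps * beta * (rho * r) ^+ n)%:E)%E.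
Proof.
have [rho0 rho00 large] := potential_large.
have [C1 C10 HC1] := kern_set_integral mu_lebesgue alpha0 alphan.
exists rho0 => // rho rhole rho1 eps eps0.
have /andP[rhop _] := rhole.
have rho01 : 0 < rho < 1 by rewrite rhop.
have [C2 C20 HC2] := layer_cake rho01.
(* The factor 4 anticipates the quarter of [U] that remains after the absorption below. *)
have [|tau tau0 tauE] := @exists_powR_lt _ alpha (eps * rho ^+ n / (4 * C1 * C2)) alpha0.
  by rewrite divr_gt0// ?mulr_gt0// exprn_gt0.
have tt0 : 0 < tau `^ (alpha - n%:R) by exact: powR_gt0.
(* This [eta] makes the coefficient of [U] on the right at most one quarter. *)
exists (4 * C2 * tau `^ (alpha - n%:R))^-1; first by rewrite invr_gt0 !mulr_gt0.
move=> r beta r0 /andP[beta0 betale] levels.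
set E := [set y | _].
have mE : measurable E by exact: measurable_level_gt.
have mF : measurable [set y | r `^ (- b) < f y] by exact: measurable_level_gt.
(* Finiteness of the measure is what permits absorbing its multiple on the right into the left
   side. *)
have Ufin : (mu E < +oo)%E by apply: u_fin; rewrite powR_gt0// mulr_gt0.
pose U := fine (mu E).
have UE : mu E = U%:E by rewrite fineK// ge0_fin_numE.
have U0 : 0 <= U by exact: fine_ge0.
have tr0 : 0 < tau * r by exact: mulr_gt0.
have main : (((rho * r) `^ (- a) / 2)%:E * mu E <=
    (C1 * (tau * r) `^ alpha + (tau * r) `^ (alpha - n%:R) * U)%:E *
    \int[mu]_(y in [set y | (r `^ (- b) < f y)%R]) (f y `^ q)%:E)%E.
  apply: (tonelli_kern_le mu_lebesgue (alpha := alpha)) => //.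
  - exact: measurable_powR_fun.
  - by move=> y; exact: powR_ge0.
  - by rewrite divr_ge0 ?powR_ge0.
  - by rewrite addr_ge0// mulr_ge0 ?powR_ge0// ltW.
  - by move=> x Ex; exact: large.
  - by move=> y; rewrite EFinD [X in (_ + X)%E]EFinM -UE; exact: HC1.
have {main} := le_trans main (lee_wpmul2l _ (HC2 r beta r0 beta0 levels)).
rewrite UE -!EFinM !lee_fin addr_ge0 ?mulr_ge0 ?powR_ge0 ?(ltW C10)// => /(_ isT).
set A := r `^ (- a); have A0 : 0 < A by exact: powR_gt0.
(* Since [b * q = a + alpha], both terms carry the factor [A], which is cancelled at the end. *)
have e1 : (tau * r) `^ alpha * r `^ (n%:R - b * q) = tau `^ alpha * (r ^+ n * A).
  rewrite (powRM _ (ltW tau0) (ltW r0)) -mulrA -powR_addp//.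
  by rewrite -powR_mulrn ?ltW// -powR_addp// bq; congr (_ * _ `^ _); ring.
have e2 : (tau * r) `^ (alpha - n%:R) * r `^ (n%:R - b * q) = tau `^ (alpha - n%:R) * A.
  rewrite (powRM _ (ltW tau0) (ltW r0)) -mulrA -powR_addp//.
  by rewrite bq; congr (_ * _ `^ _); ring.
rewrite mulrDl.
have -> : C1 * (tau * r) `^ alpha * (C2 * beta * r `^ (n%:R - b * q)) =
   C1 * C2 * beta * tau `^ alpha * r ^+ n * A.
  by transitivity (C1 * C2 * beta * ((tau * r) `^ alpha * r `^ (n%:R - b * q)));
    [ring|rewrite e1; ring].
have -> : (tau * r) `^ (alpha - n%:R) * U * (C2 * beta * r `^ (n%:R - b * q)) =
   (beta * (C2 * tau `^ (alpha - n%:R))) * U * A.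
  by transitivity (C2 * beta * U * ((tau * r) `^ (alpha - n%:R) * r `^ (n%:R - b * q)));
    [ring|rewrite e2; ring].
have small : beta * (C2 * tau `^ (alpha - n%:R)) <= 4^-1.
  rewrite -ler_pdivlMr ?mulr_gt0//; apply: le_trans betale _.
  by rewrite -invfM mulrA.
have tauU : 4 * (C1 * C2 * beta * tau `^ alpha) <= eps * rho ^+ n * beta.
  move: tauE; rewrite ler_pdivlMr ?mulr_gt0// => /(ler_wpM2l beta0).
  rewrite [X in X <= _](_ : _ = 4 * (C1 * C2 * beta * tau `^ alpha)); last by ring.
  by rewrite [X in _ <= X]mulrC.
have rhoA : A <= (rho * r) `^ (- a).
  apply: powR_le_anti; rewrite ?oppr_le0 ?(ltW a0) ?mulr_gt0//.
  by rewrite ler_piMl ?ltW.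
move=> H.
have H1 : A / 2 * U <= (C1 * C2 * beta * tau `^ alpha * r ^+ n) * A + 4^-1 * U * A.
  apply: (@le_trans _ _ ((rho * r) `^ (- a) / 2 * U)).
    by rewrite ler_wpM2r// ler_pM2r// invr_gt0.
  apply: le_trans H _; rewrite lerD2l; apply: ler_wpM2r; first exact: ltW.
  exact: ler_wpM2r.
(* Half of [U] on the left minus a quarter absorbed from the right. *)
have H2 : U <= 4 * (C1 * C2 * beta * tau `^ alpha) * r ^+ n.
  by rewrite -(ler_pM2r A0); move: H1; lra.
apply: le_trans H2 _; rewrite exprMn [leRHS]mulrA; apply: ler_wpM2r; first by rewrite exprn_ge0 ?ltW.
by rewrite [leRHS]mulrAC.
Qed.

End level_decay.

(** A step for one sequence consumes the bound on the whole tail of the other. The induction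
    therefore treats both at once and proves the rate [eps ^+ k] for all indices from [k] on; the
    claim is the case [j = k]. As [eps <= 1], the factor stays below [eta] and the steps remain
    applicable. *)
Lemma coupled_decay (R : realType) (U V : nat -> \bar R) (W : nat -> R) (eps eta : R) :
  0 < eps <= 1 -> 0 <= eta ->
  (forall k beta, 0 <= beta <= eta -> (forall j, V (k + j)%N <= (beta * W (k + j)%N)%:E)%E ->
     (U k.+1 <= (eps * beta * W k.+1)%:E)%E) ->
  (forall k beta, 0 <= beta <= eta -> (forall j, U (k + j)%N <= (beta * W (k + j)%N)%:E)%E ->
     (V k.+1 <= (eps * beta * W k.+1)%:E)%E) ->
  (forall j, U j <= (eta * W j)%:E)%E -> (forall j, V j <= (eta * W j)%:E)%E ->
  forall j, (U j <= (eta * eps ^+ j * W j)%:E)%E /\ (V j <= (eta * eps ^+ j * W j)%:E)%E.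
Proof.
move=> /andP[eps0 eps1] eta0 stepU stepV U0 V0.
suff H k : forall j, (k <= j)%N -> (U j <= (eta * eps ^+ k * W j)%:E)%E /\
    (V j <= (eta * eps ^+ k * W j)%:E)%E by move=> j; exact: H.
elim: k => [j _|k IH [//|j]]; first by rewrite expr0 mulr1.
rewrite ltnS => kj; rewrite exprS mulrCA.
have b01 : 0 <= eta * eps ^+ k <= eta.
  by rewrite mulr_ge0 ?exprn_ge0 ?(ltW eps0)//= ler_piMr// exprn_ile1// ltW.
have kji i : (k <= j + i)%N := leq_trans kj (leq_addr i j).
by split; [apply: stepU|apply: stepV] => // i; have [] := IH _ (kji i).
Qed.

(** * Boundedness and decay *)

Section bounded_and_vanishing.
Context (R : realType) (n : nat) (mu : {measure set (n.-tuple R) -> \bar R}).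
Hypothesis mu_lebesgue : is_lebesgue_measure_n mu.
Context (b : R) (b0 : 0 < b) (f : n.-tuple R -> R) (N : R).
Hypotheses (mf : measurable_fun setT f) (f0 : forall y, 0 <= f y).
Hypothesis fN : (\int[mu]_y (f y `^ (n%:R / b))%:E <= N%:E)%E.
Implicit Types x y : n.-tuple R.

Let ms : measurable_fun setT (fun y => (f y `^ (n%:R / b))%:E).
Proof. by apply/measurable_EFinP; exact: measurable_powR_fun. Qed.

Let s0 y : (0 <= (f y `^ (n%:R / b))%:E)%E.
Proof. by rewrite lee_fin powR_ge0. Qed.

Let mlev t : measurable [set y | t < f y].
Proof. exact: measurable_level_gt. Qed.

(** Chebyshev's inequality with the integral kept on the level set, so that its smallness for high
    levels can be used in [level_small]. *)
Lemma level_chebyshev t : 0 < t ->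
  (mu [set y | (t `^ (- b) < f y)%R] <=
   (t ^+ n)%:E * \int[mu]_(y in [set y | (t `^ (- b) < f y)%R]) (f y `^ (n%:R / b))%:E)%E.
Proof.
move=> t0; have tn0 : 0 < t ^+ n by exact: exprn_gt0.
rewrite -lee_pdivrMl//.
rewrite -(integral_cst mu (mlev _)).
apply: ge0_le_integral => //.
- by move=> y _; rewrite lee_fin invr_ge0 ltW.
- exact: measurable_funTS.
- move=> y /= ty; rewrite lee_fin.
  have -> : (t ^+ n)^-1 = (t `^ (- b)) `^ (n%:R / b).
    rewrite -powRrM -powR_mulrn ?ltW// -powRN; congr (_ `^ _).
    by field; rewrite gt_eqF.
  by apply: powR_le; [rewrite divr_ge0 ?(ltW b0)|exact: powR_ge0|exact: ltW].
Qed.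

Lemma level_finite t : 0 < t -> (mu [set y | (t < f y)%R] < +oo)%E.
Proof.
move=> t0; have tb : t = (t `^ (- b^-1)) `^ (- b).
  by rewrite -powRrM mulrNN mulVf ?gt_eqF// powRr1// ltW.
have t'0 : 0 < t `^ (- b^-1) by exact: powR_gt0.
rewrite {1}tb; apply: le_lt_trans (level_chebyshev t'0) _.
apply: (@le_lt_trans _ _ (((t `^ (- b^-1)) ^+ n)%:E * N%:E)%E).
  apply: lee_wpmul2l; first by rewrite lee_fin exprn_ge0 ?powR_ge0.
  by apply: le_trans fN; apply: ge0_subset_integral.
by rewrite -EFinM ltry.
Qed.

Lemma level_small eta : 0 < eta -> exists2 r0, 0 < r0 & forall t, 0 < t <= r0 ->
  (mu [set y | (t `^ (- b) < f y)%R] <= (eta * t ^+ n)%:E)%E.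
Proof.
move=> eta0.
pose z : R := 2^-1.
have z01 : 0 < z < 1 by rewrite /z invr_gt0 ltr0n invf_lt1 ?ltr1n ?ltr0n.
have z0 : 0 < z by case/andP: z01.
have out y : \forall k \near \oo, ~ [set w | (z ^+ k) `^ (- b) < f w] y.
  (* Adding 1 keeps the base of the negative power positive where [f] vanishes. *)
  have f1 : 0 < f y + 1 by rewrite ltr_wpDl.
  have p0 : 0 < (f y + 1) `^ (- b^-1) by exact: powR_gt0.
  apply: filterS (exprn_lt_eventually z01 p0) => k zk /=; apply/negP.
  rewrite -leNgt; apply: (@le_trans _ _ (f y + 1)); first by rewrite lerDl.
  rewrite -[leLHS](_ : ((f y + 1) `^ (- b^-1)) `^ (- b) = _); last first.
    by rewrite -powRrM mulrNN mulVf ?gt_eqF// powRr1// ltW.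
  by apply: powR_le_anti; rewrite ?oppr_le0 ?exprn_gt0// ltW.
have fin : (\int[mu]_y (f y `^ (n%:R / b))%:E < +oo)%E by exact: le_lt_trans fN (ltry _).
have [k _ Hk] := integral_vanishing_sets (mu := mu) (fun k => mlev ((z ^+ k) `^ (- b)))
  (measurable_powR_fun (n%:R / b) mf) (fun y => powR_ge0 (f y) _) fin out eta0.
exists (z ^+ k); first exact: exprn_gt0.
move=> t /andP[t0 tk]; apply: le_trans (level_chebyshev t0) _.
rewrite [eta * _]mulrC EFinM; apply: lee_wpmul2l; first by rewrite lee_fin exprn_ge0 ?ltW.
apply: le_trans (ltW (Hk k (leqnn k))); apply: ge0_subset_integral => //.
  exact: measurable_funTS.
move=> y /= ty; apply: le_lt_trans ty.
by apply: powR_le_anti; rewrite ?oppr_le0 ?(ltW b0).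
Qed.

Context (alpha : R).
Hypotheses (alpha0 : 0 < alpha) (alphan : alpha < n%:R).
Context (a q : R).
Hypotheses (a0 : 0 < a) (q0 : 0 < q).
Hypotheses (bq : b * q = a + alpha) (bqn : b * q < n%:R).

Local Notation K := (kern alpha).

Let mF x : measurable_fun setT (fun y => (f y `^ q * K x y)%:E).
Proof. by apply/measurable_EFinP; exact: measurable_potential. Qed.

Let F0 x y : (0 <= (f y `^ q * K x y)%:E)%E.
Proof. by rewrite lee_fin mulr_ge0 ?powR_ge0. Qed.

Lemma potential_bounded rho : 0 < rho < 1 -> exists2 eps0, 0 < eps0 &
  forall eps r eta, 0 < eps <= eps0 -> 0 < r -> 0 <= eta ->
  (forall j : nat, (mu [set y | ((r * rho ^+ j) `^ (- b) < f y)%R]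
      <= (eta * eps ^+ j * (r * rho ^+ j) ^+ n)%:E)%E) ->
  exists M, forall x, (\int[mu]_y (f y `^ q * K x y)%:E <= M%:E)%E.
Proof.
move=> rho01; have /andP[rho0 rho1] := rho01.
have [C1 C10 HC1] := kern_set_integral mu_lebesgue alpha0 alphan.
have [C2 C20 HC2] := potential_le mu_lebesgue alpha0 alphan a0 b0 q0 bq bqn.
pose P := rho `^ (- (b * q)); have P0 : 0 < P by exact: powR_gt0.
(* First [chi] gives the ball terms ratio at most 1/2; then [eps0] does the same for the measure
   terms, whose power of [chi] is large. *)
have [|chi chi0 chiE] := @exists_powR_lt _ alpha (2^-1 / P) alpha0.
  by rewrite divr_gt0.
have ct0 : 0 < chi `^ (alpha - n%:R) by exact: powR_gt0.
have rn0 : 0 < rho ^+ n by exact: exprn_gt0.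
exists (2^-1 / (P * chi `^ (alpha - n%:R) * rho ^+ n)); first by rewrite divr_gt0 ?mulr_gt0.
move=> eps r eta /andP[eps0 epsle] r0 eta0 levels.
have mS : measurable [set y | f y <= r `^ (- b)] by exact: measurable_level_le.
pose M1 := C2 * ((r `^ (- b)) `^ q * r `^ alpha + 1 `^ q * r `^ (- a))
    + 1 `^ (q - n%:R / b) * N * r `^ (- a).
pose B := (r * rho) `^ (- (b * q)) * (C1 + eta * r ^+ n).
exists (M1 + B / (1 - 2^-1)) => x.
rewrite (ge0_integral_setID _ measurableT mS (mF x))// setTI.
have -> : [set: n.-tuple R] `\` [set y | f y <= r `^ (- b)] = [set y | r `^ (- b) < f y].
  by apply/seteqP; split => y /=; [case=> _ /negP; rewrite -ltNge|rewrite ltNge => /negP].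
rewrite EFinD; apply: leeD.
  apply: HC2 => //; first exact: powR_ge0.
  by apply: le_trans fN; apply: ge0_subset_integral.
have j1 : P * chi `^ alpha <= 2^-1 by rewrite mulrC -ler_pdivlMr.
have j2 : P * chi `^ (alpha - n%:R) * rho ^+ n * eps <= 2^-1.
  by rewrite mulrC -ler_pdivlMr ?mulr_gt0.
apply: (@cover_integral_geometric _ _ _ mu _
   (fun j => [set y | (r * rho ^+ j) `^ (- b) < f y]) _ _
   (fun j => (r * rho ^+ j.+1) `^ (- (b * q)))) => //.
- exact: measurable_powR_fun.
- exact: measurable_kern.
- by move=> y; exact: powR_ge0.
- by move=> y; exact: kern_ge0.
- by move=> j; exact: powR_ge0.
- by move=> y /= rf; exact: level_cover.
- by rewrite mulr_ge0 ?powR_ge0// addr_ge0 ?(ltW C10)// mulr_ge0 ?exprn_ge0 ?(ltW r0).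
- by rewrite invr_gt0 ltr0n invf_lt1 ?ltr1n ?ltr0n.
move=> j; have cj0 : 0 < chi ^+ j by exact: exprn_gt0.
have p0 : 0 <= (r * rho ^+ j.+1) `^ (- (b * q)) by exact: powR_ge0.
apply: (@le_trans _ _ (((r * rho ^+ j.+1) `^ (- (b * q)))%:E *
  (C1 * (chi ^+ j) `^ alpha +
   (chi ^+ j) `^ (alpha - n%:R) * (eta * eps ^+ j * (r * rho ^+ j) ^+ n))%:E)%E).
  apply: lee_wpmul2l; first by rewrite lee_fin.
  apply: le_trans (HC1 _ x _ (mlev _) cj0) _.
  rewrite EFinD [X in (_ <= _ + X)%E]EFinM; apply: leeD => //.
  by apply: lee_wpmul2l; rewrite ?lee_fin ?powR_ge0.
have chiX s : (chi ^+ j) `^ s = (chi `^ s) ^+ j.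
  by have := powR_mul_exprn s j (@ler01 R) (ltW chi0); rewrite mul1r powR1 mul1r.
rewrite -EFinM lee_fin !chiX exprMn -exprM mulnC exprM.
rewrite (_ : r * rho ^+ j.+1 = r * rho * rho ^+ j); last by rewrite exprS mulrA.
rewrite (powR_mul_exprn _ _ (ltW (mulr_gt0 r0 rho0)) (ltW rho0)) -/P.
set Q := (r * rho) `^ (- (b * q)).
rewrite [leLHS](_ : _ = Q * (C1 * (P * chi `^ alpha) ^+ j +
   eta * r ^+ n * (P * chi `^ (alpha - n%:R) * rho ^+ n * eps) ^+ j)); last first.
  by rewrite !exprMn; ring.
have h0 : 0 <= 2^-1 :> R by rewrite invr_ge0.
rewrite /B -/Q -[leRHS]mulrA; apply: ler_wpM2l; first exact: powR_ge0.
rewrite mulrDl; apply: lerD; apply: ler_wpM2l.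
- exact: ltW.
- by rewrite lerXn2r ?nnegrE// mulr_ge0 ?powR_ge0// ltW.
- by rewrite mulr_ge0 ?exprn_ge0 ?(ltW r0).
- rewrite lerXn2r ?nnegrE//.
  by rewrite !mulr_ge0 ?powR_ge0 ?(ltW P0) ?(ltW rn0) ?(ltW eps0).
Qed.

Lemma potential_vanishing m : (forall y, f y <= m) ->
  forall e, 0 < e -> exists L, forall x, L < enorm x ->
  (\int[mu]_y (f y `^ q * K x y)%:E < e%:E)%E.
Proof.
move=> fm e e0.
have m0 : 0 <= m by apply: le_trans (f0 [tuple 0 | _ < n]) (fm _).
have [C C0 HC] := potential_le mu_lebesgue alpha0 alphan a0 b0 q0 bq bqn.
have mq0 : 0 <= m `^ q by exact: powR_ge0.
(* The order of choice is [r], [sg], [N']: each makes one term of [potential_le] at most [e / 8] and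
   depends on the earlier ones. *)
have [|r r0 rE] := @exists_powR_lt _ alpha (e / 8 / (C * (m `^ q + 1))) alpha0.
  by rewrite !divr_gt0// mulr_gt0// ltr_wpDl.
have ra0 : 0 < r `^ (- a) by exact: powR_gt0.
have [|sg sg0 sgE] := @exists_powR_lt _ q (e / 8 / (C * r `^ (- a))) q0.
  by rewrite !divr_gt0// mulr_gt0.
have sp0 : 0 < sg `^ (q - n%:R / b) by exact: powR_gt0.
pose N' := e / 8 / (sg `^ (q - n%:R / b) * r `^ (- a)).
have N'0 : 0 < N' by rewrite !divr_gt0// mulr_gt0.
have mA k : measurable [set y : n.-tuple R | k < enorm y].
  exact: measurable_level_gt (@measurable_enorm R n).
have out y : \forall k \near \oo, ~ [set w : n.-tuple R | (k%:R : R) < enorm w] y.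
  exists (Num.truncn (enorm y)).+1 => // k /= tk; apply/negP; rewrite -leNgt.
  by apply: le_trans (ltW (truncnS_gt _)) _; rewrite ler_nat.
have fin : (\int[mu]_y (f y `^ (n%:R / b))%:E < +oo)%E by exact: le_lt_trans fN (ltry _).
have [k _ Hk] := integral_vanishing_sets (mu := mu) (fun k => mA k%:R)
  (measurable_powR_fun (n%:R / b) mf) (fun y => powR_ge0 (f y) _) fin out N'0.
have {}Hk := Hk k (leqnn k).
pose vol : R := (2 * k%:R) ^+ n.
have vol0 : 0 <= vol by rewrite exprn_ge0// mulr_ge0.
have na0 : 0 < n%:R - alpha by rewrite subr_gt0.
have [|tau tau0 tauE] := @exists_powR_lt _ _ (e / 2 / ((m `^ q + 1) * (vol + 1))) na0.
  by rewrite !divr_gt0// mulr_gt0// ltr_wpDl.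
(* [S] is the distance at which the kernel beats the density and volume of the inner part. *)
pose S := tau^-1; have S0 : 0 < S by rewrite invr_gt0.
(* Its square exceeds [2 * S ^+ 2 + 2 * k%:R ^+ 2], the bound that [enorm_sqr_le] would give if [y]
   were closer than [S] to [x]. *)
exists (2 * (k%:R + S)) => x xL.
rewrite (ge0_integral_setID _ measurableT (mA k%:R) (mF x))// setTI.
have -> : [set: n.-tuple R] `\` [set y | k%:R < enorm y] = [set y | enorm y <= k%:R].
  by apply/seteqP; split => y /=; [case=> _ /negP; rewrite -leNgt|rewrite leNgt => /negP].
have far : (\int[mu]_(y in [set y : n.-tuple R | (k%:R < enorm y)%R])
    (f y `^ q * K x y)%:E <= (3 * (e / 8))%:E)%E.
  apply: le_trans (HC _ f m N' x r sg (mA k%:R) mf f0 m0 (fun y _ => fm y) (ltW Hk) r0 sg0) _.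
  rewrite lee_fin.
  have h1 : C * (m `^ q * r `^ alpha) <= e / 8.
    move: rE; rewrite ler_pdivlMr ?mulr_gt0 ?ltr_wpDl//; apply: le_trans.
    rewrite mulrA mulrC; apply: ler_wpM2l; first exact: powR_ge0.
    by apply: ler_wpM2l; [exact: ltW|rewrite lerDl].
  have h2 : C * (sg `^ q * r `^ (- a)) <= e / 8.
    move: sgE; rewrite ler_pdivlMr ?mulr_gt0//; apply: le_trans.
    by rewrite mulrCA.
  have h3 : sg `^ (q - n%:R / b) * N' * r `^ (- a) = e / 8.
    by rewrite /N'; field; rewrite !gt_eqF.
  by rewrite h3 mulrDr; lra.
have xy y : enorm y <= k%:R -> S <= edist x y.
  move=> yk; have k0 : 0 <= k%:R :> R by exact: ler0n.
  have y0 : 0 <= enorm y by exact: sqrtr_ge0.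
  have H := enorm_sqr_le x y; have d0 := edist_ge0 x y.
  rewrite leNgt; apply/negP => dS; suff : enorm x ^+ 2 < enorm x ^+ 2 by rewrite ltxx.
  apply: le_lt_trans H _.
  have h1 : enorm y ^+ 2 <= k%:R ^+ 2 by rewrite lerXn2r ?nnegrE.
  have h2 : edist x y ^+ 2 <= S ^+ 2 by rewrite lerXn2r ?nnegrE// ltW.
  have h3 : (2 * (k%:R + S)) ^+ 2 <= enorm x ^+ 2.
    by rewrite lerXn2r ?nnegrE ?ltW// ?mulr_gt0 ?ltr_wpDl// (lt_trans _ xL)// mulr_gt0// ltr_wpDl.
  have h4 : 0 < S ^+ 2 by exact: exprn_gt0.
  have h5 : 0 <= k%:R * S by rewrite mulr_ge0// ltW.
  by nra.
have near : (\int[mu]_(y in [set y : n.-tuple R | (enorm y <= k%:R)%R])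
    (f y `^ q * K x y)%:E <= (e / 2)%:E)%E.
  have mE : measurable [set y : n.-tuple R | enorm y <= k%:R].
    exact: measurable_level_le (@measurable_enorm R n).
  have k1 : 0 <= m `^ q * S `^ (alpha - n%:R) by rewrite mulr_ge0 ?powR_ge0.
  apply: (@le_trans _ _ ((m `^ q * S `^ (alpha - n%:R))%:E * vol%:E)%E).
    apply: (@le_trans _ _ ((m `^ q * S `^ (alpha - n%:R))%:E *
       mu [set y : n.-tuple R | (enorm y <= k%:R)%R])%E).
      rewrite -(integral_cst mu mE); apply: ge0_le_integral => //.
      - exact: measurable_funTS.
      - move=> y /= yk; rewrite lee_fin ler_pM ?powR_ge0//.
          by apply: powR_le; [exact: ltW|exact: f0|exact: fm].
        by apply: powR_le_anti; [rewrite subr_le0 ltW|exact: S0|exact: xy].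
    apply: lee_wpmul2l; first by rewrite lee_fin.
    have -> : @enorm R n = edist [tuple 0 | _ < n].
      apply/funext => y; rewrite /enorm /edist; congr (Num.sqrt _).
      by apply: eq_bigr => i _; rewrite tnth_mktuple sub0r sqrrN.
    exact: ball_measure_le.
  rewrite -EFinM lee_fin.
  have -> : S `^ (alpha - n%:R) = tau `^ (n%:R - alpha).
    by rewrite /S -powR_inv1 ?ltW// -powRrM mulN1r opprB.
  move: tauE; rewrite ler_pdivlMr ?mulr_gt0 ?ltr_wpDl//; apply: le_trans.
  rewrite mulrAC mulrC; apply: ler_wpM2l; first exact: powR_ge0.
  by apply: ler_pM => //; rewrite lerDl.
apply: (le_lt_trans (leeD far near)); rewrite -EFinD lte_fin; lra.
Qed.

End bounded_and_vanishing.

(** [powRN] also covers the base 0, so the quotient and the product agree on the diagonal. *)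
Lemma riesz_potE (R : realType) (n : nat) (mu : {measure set (n.-tuple R) -> \bar R})
    (alpha q : R) (f : n.-tuple R -> R) x :
  riesz_pot mu alpha (fun y => f y `^ q) x =
  (\int[mu]_y (f y `^ q * kern alpha x y)%:E)%E.
Proof.
by apply: eq_integral => y _; rewrite /kern -powRN opprB.
Qed.

(** * The coupled system *)

Section integral_system.
Context (R : realType) (n : nat) (mu : {measure set (n.-tuple R) -> \bar R}).
Hypothesis mu_lebesgue : is_lebesgue_measure_n mu.
Context (alpha : R).
Hypotheses (alpha0 : 0 < alpha) (alphan : alpha < n%:R).
Context (a b p q : R).
Hypotheses (a0 : 0 < a) (b0 : 0 < b) (p0 : 0 < p) (q0 : 0 < q).
Hypotheses (bq : b * q = a + alpha) (bqn : b * q < n%:R).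
Hypotheses (ap : a * p = b + alpha) (apn : a * p < n%:R).
Context (u v : n.-tuple R -> R) (Nu Nv : R).
Hypotheses (mu_u : measurable_fun setT u) (mu_v : measurable_fun setT v).
Hypotheses (u0 : forall y, 0 <= u y) (v0 : forall y, 0 <= v y).
Hypothesis u_Lp : (\int[mu]_y (u y `^ (n%:R / a))%:E <= Nu%:E)%E.
Hypothesis v_Lp : (\int[mu]_y (v y `^ (n%:R / b))%:E <= Nv%:E)%E.
Hypothesis uE : forall x, ((u x)%:E = \int[mu]_y (v y `^ q * kern alpha x y)%:E)%E.
Hypothesis vE : forall x, ((v x)%:E = \int[mu]_y (u y `^ p * kern alpha x y)%:E)%E.

(** The constants are chosen in the order [rho], [eps], [eta], [r], each common to both equations:
    [rho] from the improvement lemma, [eps] from what boundedness demands at that [rho], [eta] from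
    the improvement by that [eps], and [r] so that all level sets start below [eta]. *)
Lemma system_bounded : exists M, forall x, u x <= M /\ v x <= M.
Proof.
have u_le x : ((u x)%:E <= \int[mu]_y (v y `^ q * kern alpha x y)%:E)%E by rewrite uE.
have v_le x : ((v x)%:E <= \int[mu]_y (u y `^ p * kern alpha x y)%:E)%E by rewrite vE.
have u_fin := level_finite a0 mu_u u_Lp.
have v_fin := level_finite b0 mu_v v_Lp.
have [rho1 rho10 improve_u] := level_improve mu_lebesgue alpha0 alphan a0 b0 q0 bq bqn
  mu_v v0 mu_u v_Lp u_le u_fin.
have [rho2 rho20 improve_v] := level_improve mu_lebesgue alpha0 alphan b0 a0 p0 ap apn
  mu_u u0 mu_v u_Lp v_le v_fin.
pose rho := Num.min (2^-1) (Num.min rho1 rho2).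
have rho0 : 0 < rho by rewrite !lt_min rho10 rho20 invr_gt0 ltr0n.
have rho_lt1 : rho < 1.
  by rewrite gt_min; apply/orP; left; rewrite invf_lt1 ?ltr1n ?ltr0n.
have rho_le1 : 0 < rho <= rho1 by rewrite rho0 !ge_min lexx !orbT.
have rho_le2 : 0 < rho <= rho2 by rewrite rho0 !ge_min lexx !orbT.
have rho01 : 0 < rho < 1 by rewrite rho0.
have [e1 e10 bounded_u] := potential_bounded mu_lebesgue b0 mu_v v0 v_Lp
  alpha0 alphan a0 q0 bq bqn rho01.
have [e2 e20 bounded_v] := potential_bounded mu_lebesgue a0 mu_u u0 u_Lp
  alpha0 alphan b0 p0 ap apn rho01.
pose eps := Num.min 1 (Num.min e1 e2).
have eps0 : 0 < eps by rewrite !lt_min e10 e20 ltr01.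
have eps1 : 0 < eps <= 1 by rewrite eps0 ge_min lexx.
have eps_le1 : 0 < eps <= e1 by rewrite eps0 !ge_min lexx !orbT.
have eps_le2 : 0 < eps <= e2 by rewrite eps0 !ge_min lexx !orbT.
have [eta1 eta10 step_u] := improve_u rho rho_le1 rho_lt1 eps eps0.
have [eta2 eta20 step_v] := improve_v rho rho_le2 rho_lt1 eps eps0.
pose eta := Num.min eta1 eta2.
have eta0 : 0 < eta by rewrite lt_min eta10.
have eta_le1 : eta <= eta1 by rewrite ge_min lexx.
have eta_le2 : eta <= eta2 by rewrite ge_min lexx orbT.
have [r1 r10 small_u] := level_small a0 mu_u u0 u_Lp eta0.
have [r2 r20 small_v] := level_small b0 mu_v v0 v_Lp eta0.
pose r := Num.min r1 r2.
have r0 : 0 < r by rewrite lt_min r10.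
have r_le1 : r <= r1 by rewrite ge_min lexx.
have r_le2 : r <= r2 by rewrite ge_min lexx orbT.
have rj0 j : 0 < r * rho ^+ j by rewrite mulr_gt0// exprn_gt0.
have rj j : r * rho ^+ j <= r.
  by rewrite ler_piMr ?(ltW r0)// exprn_ile1// ltW.
have rS k : rho * (r * rho ^+ k) = r * rho ^+ k.+1 by rewrite exprS mulrCA.
have rD k j : r * rho ^+ k * rho ^+ j = r * rho ^+ (k + j) by rewrite exprD mulrA.
(* Index [j] stands for the radius [r * rho ^+ j], and the measures are compared with its [n]-th
   power. *)
have decay := @coupled_decay R
  (fun j => mu [set y | (r * rho ^+ j) `^ (- a) < u y])
  (fun j => mu [set y | (r * rho ^+ j) `^ (- b) < v y])
  (fun j => (r * rho ^+ j) ^+ n) eps eta eps1 (ltW eta0).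
have {}decay : forall j,
    (mu [set y | ((r * rho ^+ j) `^ (- a) < u y)%R] <=
       (eta * eps ^+ j * (r * rho ^+ j) ^+ n)%:E)%E /\
    (mu [set y | ((r * rho ^+ j) `^ (- b) < v y)%R] <=
       (eta * eps ^+ j * (r * rho ^+ j) ^+ n)%:E)%E.
  apply: decay.
  - move=> k beta /andP[beta0 betale] levels; rewrite -rS.
    apply: step_u => // [|j]; first by rewrite beta0 (le_trans betale).
    by rewrite rD; exact: levels.
  - move=> k beta /andP[beta0 betale] levels; rewrite -rS.
    apply: step_v => // [|j]; first by rewrite beta0 (le_trans betale).
    by rewrite rD; exact: levels.
  - by move=> j; apply: small_u; rewrite rj0 (le_trans (rj j)).
  - by move=> j; apply: small_v; rewrite rj0 (le_trans (rj j)).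
have [M1 HM1] := bounded_u eps r eta eps_le1 r0 (ltW eta0) (fun j => (decay j).2).
have [M2 HM2] := bounded_v eps r eta eps_le2 r0 (ltW eta0) (fun j => (decay j).1).
exists (Num.max M1 M2) => x.
have ux : u x <= M1 by rewrite -lee_fin uE; exact: HM1.
have vx : v x <= M2 by rewrite -lee_fin vE; exact: HM2.
by rewrite !le_max ux vx orbT.
Qed.

Lemma system_bounded_vanishing :
  (exists M, forall x, u x <= M /\ v x <= M) /\
  forall e, 0 < e -> exists L, forall x, L < enorm x -> u x < e /\ v x < e.
Proof.
have [M HM] := system_bounded; split; first by exists M.
move=> e e0.
have [L1 HL1] := potential_vanishing mu_lebesgue b0 mu_v v0 v_Lp alpha0 alphan
  a0 q0 bq bqn (fun y => (HM y).2) e0.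
have [L2 HL2] := potential_vanishing mu_lebesgue a0 mu_u u0 u_Lp alpha0 alphan
  b0 p0 ap apn (fun y => (HM y).1) e0.
exists (Num.max L1 L2) => x; rewrite gt_max => /andP[xL1 xL2].
by rewrite -!lte_fin uE vE HL1 ?HL2.
Qed.

End integral_system.

Unset Implicit Arguments.

Theorem theorem3p1 (R : realType) (n : nat)
  (mu : {measure set (n.-tuple R) -> \bar R})
  (alpha p q : R) (u v : n.-tuple R -> R) :
  is_lebesgue_measure_n mu ->
  (3 <= n)%N ->
  0 < alpha -> alpha < n%:R ->
  0 < p -> 0 < q -> 1 < p * q ->
  (p + 1)^-1 + (q + 1)^-1 <= (n%:R - alpha) / n%:R ->
  in_Lp mu (n%:R * (p * q - 1) / (alpha * (q + 1))) u ->
  in_Lp mu (n%:R * (p * q - 1) / (alpha * (p + 1))) v ->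
  (forall x, 0 < u x) -> (forall x, 0 < v x) ->
  (forall x, (u x)%:E = riesz_pot mu alpha (fun y => v y `^ q) x) ->
  (forall x, (v x)%:E = riesz_pot mu alpha (fun y => u y `^ p) x) ->
  bounded_fun_Rn u /\ bounded_fun_Rn v /\
  vanish_at_infinity u /\ vanish_at_infinity v.
Proof.
move=> mu_lebesgue n3 alpha0 alphan p0 q0 pq1 pqn [mu_u u_Lp] [mu_v v_Lp] u_gt0 v_gt0 uE vE.
have n0 : (0 : R) < n%:R by rewrite ltr0n (leq_trans _ n3).
have d0 : 0 < p * q - 1 by rewrite subr_gt0.
have p1 : 0 < p + 1 by rewrite ltr_wpDr.
have q1 : 0 < q + 1 by rewrite ltr_wpDr.
pose a := alpha * (q + 1) / (p * q - 1).
pose b := alpha * (p + 1) / (p * q - 1).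
have a0 : 0 < a by rewrite divr_gt0// mulr_gt0.
have b0 : 0 < b by rewrite divr_gt0// mulr_gt0.
have bq : b * q = a + alpha by rewrite /a /b; field; rewrite gt_eqF.
have ap : a * p = b + alpha by rewrite /a /b; field; rewrite gt_eqF.
(* The condition on the exponents multiplied by [n%:R * ((p + 1) * (q + 1))]. Replacing [q + 1] by
   [q], or [p + 1] by [p], then yields the strict bounds [bqn] and [apn]. *)
have crit : alpha * (p + 1) * (q + 1) <= n%:R * (p * q - 1).
  have : n%:R * ((p + 1) * (q + 1)) * ((p + 1)^-1 + (q + 1)^-1) <=
         n%:R * ((p + 1) * (q + 1)) * ((n%:R - alpha) / n%:R).
    by apply: ler_wpM2l pqn; rewrite !mulr_ge0 ?ltW.
  have -> : n%:R * ((p + 1) * (q + 1)) * ((p + 1)^-1 + (q + 1)^-1) = n%:R * (p + q + 2).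
    by field; rewrite !gt_eqF.
  have -> : n%:R * ((p + 1) * (q + 1)) * ((n%:R - alpha) / n%:R) =
      (p + 1) * (q + 1) * (n%:R - alpha).
    by field; rewrite gt_eqF.
  by move=> ?; nra.
have bqn : b * q < n%:R.
  rewrite /b mulrAC ltr_pdivrMr//; apply: lt_le_trans crit.
  by rewrite ltr_pM2l ?mulr_gt0// ltrDl.
have apn : a * p < n%:R.
  rewrite /a mulrAC ltr_pdivrMr//; apply: lt_le_trans crit.
  by rewrite mulrAC -[ltRHS]mulrAC mulrAC ltr_pM2l ?mulr_gt0// ltrDl.
have r0E : n%:R * (p * q - 1) / (alpha * (q + 1)) = n%:R / a.
  by rewrite /a; field; rewrite !gt_eqF.
have s0E : n%:R * (p * q - 1) / (alpha * (p + 1)) = n%:R / b.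
  by rewrite /b; field; rewrite !gt_eqF.
have finE (w : n.-tuple R -> R) s : (forall x, 0 < w x) ->
    (\int[mu]_x (`|w x| `^ s)%:E < +oo)%E ->
    exists N, (\int[mu]_x (w x `^ s)%:E <= N%:E)%E.
  move=> w0; under eq_integral do rewrite (gtr0_norm (w0 _)).
  move=> fin; exists (fine (\int[mu]_x (w x `^ s)%:E)); rewrite fineK//.
  by rewrite ge0_fin_numE// integral_ge0// => x _; rewrite lee_fin powR_ge0.
rewrite r0E in u_Lp; rewrite s0E in v_Lp.
have [Nu {}u_Lp] := finE u _ u_gt0 u_Lp.
have [Nv {}v_Lp] := finE v _ v_gt0 v_Lp.
have {}uE x : ((u x)%:E = \int[mu]_y (v y `^ q * kern alpha x y)%:E)%E.
  by rewrite uE riesz_potE.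
have {}vE x : ((v x)%:E = \int[mu]_y (u y `^ p * kern alpha x y)%:E)%E.
  by rewrite vE riesz_potE.
have [[M HM] vanish] := system_bounded_vanishing mu_lebesgue alpha0 alphan a0 b0 p0 q0
  bq bqn ap apn mu_u mu_v (fun y => ltW (u_gt0 y)) (fun y => ltW (v_gt0 y)) u_Lp v_Lp uE vE.
split; first by exists M => x; rewrite gtr0_norm//; case: (HM x).
split; first by exists M => x; rewrite gtr0_norm//; case: (HM x).
split=> e /vanish[L HL]; exists L => x /HL[ux vx]; by rewrite gtr0_norm.
Qed.
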